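(* Let $\mathcal{H}$ be any set of infinitely edge-connected graphs such that every infinitely edge-connected graph has a minor in $\mathcal{H}$ and no element of $\mathcal{H}$ is a minor of another element of $\mathcal{H}$. Then $\mathcal{H}$ consists of exactly two graphs, one of which is minor-equivalent to the Farey graph and the other of which is minor-equivalent to $T_{\aleph_0} * t$.
   Context: Graphs are simple and may be infinite. A graph is infinitely edge-connected if no two distinct vertices can be separated by deleting finitely many edges. A graph $H$ is a minor of $G$ if there are disjoint non-empty vertex sets $V_h\subseteq V(G)$ ($h\in V(H)$), each inducing a connected subgraph of $G$, such that $G$ has a $V_h$–$V_{h'}$ edge whenever $hh'\in E(H)$. Two graphs are minor-equivalent if each is a minor of the other. The Farey graph is the graph on $\mathbb{Q}\cup\{\infty\}$ in which $a/b$ and $c/d$ in lowest terms (with $\infty=(\pm1)/0$) are adjacent iff $ad-bc=\pm1$. $T_{\aleph_0}$ is the tree in which every vertex has countably infinite degree, and $T_{\aleph_0}*t$ is obtained from it by adding a new vertex $t$ adjacent to all its vertices.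
   Formalization: An infinitely edge-connected graph is required to have at least two vertices; under the literal definition the one-vertex graph would qualify and the set consisting of it alone would be a counterexample. *)

(* Defs.v *)
From Stdlib Require Export Relation_Operators.
From mathcomp Require Export all_boot all_order all_algebra.
From mathcomp Require Export boolp classical_sets functions cardinality.

Set Implicit Arguments.
Unset Strict Implicit.
Unset Printing Implicit Defensive.

Import Order.TTheory GRing.Theory Num.Theory.

Local Open Scope classical_set_scope.

Record graph := Graph {
  vertex :> Type;
  adj : vertex -> vertex -> Prop;
  adj_sym : forall x y, adj x y -> adj y x;
  adj_irrefl : forall x, ~ adj x x }.

Arguments adj {g} x y.

Definition edges (G : graph) : set (set G) :=
  [set e | exists x y : G, adj x y /\ e = [set x; y]].
Arguments edges G : clear implicits.

Definition induced_adj (G : graph) (U : set G) (x y : {v : G | U v}) : Prop :=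
  adj (sval x) (sval y).

Lemma induced_adj_sym (G : graph) (U : set G) (x y : {v : G | U v}) :
  induced_adj x y -> induced_adj y x.
Proof. exact: adj_sym. Qed.

Lemma induced_adj_irrefl (G : graph) (U : set G) (x : {v : G | U v}) :
  ~ induced_adj x x.
Proof. exact: adj_irrefl. Qed.

Definition induced (G : graph) (U : set G) : graph :=
  Graph (@induced_adj_sym G U) (@induced_adj_irrefl G U).

Definition delete_adj (G : graph) (F : set (set G)) (x y : G) : Prop :=
  adj x y /\ ~ F [set x; y].

Lemma delete_adj_sym (G : graph) (F : set (set G)) (x y : G) :
  delete_adj F x y -> delete_adj F y x.
Proof. by move=> [xy nF]; split; [exact: adj_sym | rewrite setUC]. Qed.

Lemma delete_adj_irrefl (G : graph) (F : set (set G)) (x : G) :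
  ~ delete_adj F x x.
Proof. by move=> [/adj_irrefl]. Qed.

Definition delete_edges (G : graph) (F : set (set G)) : graph :=
  Graph (@delete_adj_sym G F) (@delete_adj_irrefl G F).

Definition linked (G : graph) : G -> G -> Prop := clos_refl_trans G adj.

Definition connected_graph (G : graph) : Prop := forall x y : G, linked x y.

(* As usual for edge-connectivity, a graph with at most one vertex does not
   count as infinitely edge-connected. *)
Definition infinitely_edge_connected (G : graph) : Prop :=
  (exists x y : G, x <> y) /\
  forall x y : G, x <> y ->
    forall F : set (set G), finite_set F -> F `<=` edges G ->
      @linked (delete_edges F) x y.

Definition minor (H G : graph) : Prop :=
  exists V : H -> set G,
    [/\ forall h, V h !=set0,
        trivIset [set: H] V,
        forall h, connected_graph (induced (V h))
      & forall h h', adj h h' ->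
          exists x y, [/\ V h x, V h' y & adj x y]].

Definition minor_equivalent (G H : graph) : Prop := minor G H /\ minor H G.

(* [None] is the vertex infinity, written 1/0. *)
Definition farey_num (x : option rat) : int :=
  if x is Some q then numq q else 1%R.

Definition farey_den (x : option rat) : int :=
  if x is Some q then denq q else 0%R.

(* Lowest terms determine numerator and denominator up to a common sign, on
   which the condition does not depend. *)
Definition farey_adj (x y : option rat) : Prop :=
  let d := (farey_num x * farey_den y - farey_den x * farey_num y)%R in
  d = 1%R \/ d = (-1)%R.

Lemma farey_adj_sym x y : farey_adj x y -> farey_adj y x.
Proof.
rewrite /farey_adj /= -[(farey_num y * _ - _)%R]opprB.
rewrite [(farey_den y * _)%R]mulrC [(farey_num y * _)%R]mulrC.
by case=> ->; [right | left; rewrite opprK].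
Qed.

Lemma farey_adj_irrefl x : ~ farey_adj x x.
Proof. by rewrite /farey_adj /= [(farey_den x * _)%R]mulrC subrr => -[]. Qed.

Definition farey_graph : graph := Graph farey_adj_sym farey_adj_irrefl.

(* The tree of finite sequences of naturals, rooted at [::], the children of
   [s] being the sequences [n :: s]. *)
Definition tree_adj (s t : seq nat) : Prop :=
  (exists n, t = n :: s) \/ (exists n, s = n :: t).

Lemma tree_adj_sym s t : tree_adj s t -> tree_adj t s.
Proof. by case; [right | left]. Qed.

Lemma tree_adj_irrefl s : ~ tree_adj s s.
Proof. by case=> -[n /(congr1 size)] /= /n_Sn. Qed.

Definition T_aleph0 : graph := Graph tree_adj_sym tree_adj_irrefl.

Definition has_cycle (G : graph) : Prop :=
  exists (n : nat) (c : 'I_n -> G),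
    [/\ (2 < n)%N, injective c & forall i, adj (c i) (c (ordS i))].

Definition is_tree (G : graph) : Prop :=
  [/\ inhabited G, connected_graph G & ~ has_cycle G].

Definition countably_infinite_degree (G : graph) (x : G) : Prop :=
  ([set y | adj x y] #= [set: nat])%card.

(* [T_aleph0] is indeed the tree, unique up to isomorphism, in which every
   vertex has countably infinite degree. *)
Lemma T_aleph0_is_tree : is_tree T_aleph0.
Proof.
have up (s : T_aleph0) : linked s ([::] : T_aleph0) /\ linked ([::] : T_aleph0) s.
  elim: s => [|n s [IH1 IH2]]; first by split; exact: rt_refl.
  split.
  - by apply: rt_trans IH1; apply: rt_step; right; exists n.
  - by apply: (rt_trans _ _ _ _ _ IH2); apply: rt_step; left; exists n.
split.
- exact: (inhabits ([::] : T_aleph0)).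
- by move=> x y; apply: rt_trans (up x).1 (up y).2.
case=> n [c [n2 cI cA]].
have n0 : (0 < n)%N by exact: leq_trans n2.
case: (@arg_maxnP _ (Ordinal n0) xpredT (fun i => size (c i)) isT) => i _ imax.
have low (j : 'I_n) : adj (c i) (c j) -> c j = behead (c i).
  case=> -[k e]; last by rewrite e.
  by have := imax j isT; rewrite e /= ltnn.
have e1 := low _ (cA i).
have e2 : c (ord_pred i) = behead (c i).
  by apply: low; apply: adj_sym; rewrite -{2}[i]ord_predK; exact: cA.
have /(congr1 val) /= : ordS (ord_pred i) = ordS (ordS i).
  by congr ordS; apply: cI; rewrite e2.
rewrite [X in X = _](congr1 val (ord_predK i)) /= => e.
have {}e : (i + 0 = i + 2 %[mod n])%N.
  by rewrite addn0 modn_small // {1}e -addn1 modnDml addn1 addn2.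
by move/eqP: e; rewrite eqn_modDl mod0n modn_small.
Qed.

Lemma T_aleph0_degree (x : T_aleph0) : countably_infinite_degree x.
Proof.
apply: eq_card_nat; first exact: (@countableP (seq nat)).
apply/infiniteP; have xI : {in [set: nat] &, injective (fun n => n :: x)}.
  by move=> m n _ _ [].
rewrite -(card_le_eql (inj_card_eq xI)).
by apply: subset_card_le => _ [n _ <-]; left; exists n.
Qed.

Definition cone_adj (G : graph) (x y : option G) : Prop :=
  match x, y with
  | Some u, Some v => adj u v
  | None, None => False
  | _, _ => True
  end.

Lemma cone_adj_sym (G : graph) (x y : option G) :
  cone_adj x y -> cone_adj y x.
Proof. by case: x y => [x|] [y|] //; exact: adj_sym. Qed.

Lemma cone_adj_irrefl (G : graph) (x : option G) : ~ cone_adj x x.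
Proof. by case: x => [x|] //; exact: adj_irrefl. Qed.

(* [cone G] is G * t, the new vertex t being [None]. *)
Definition cone (G : graph) : graph :=
  Graph (@cone_adj_sym G) (@cone_adj_irrefl G).

(* Main.v *)
Require Import Defs.
From mathcomp Require Import zify ring.

(** Everything takes place inside one infinitely edge-connected graph G.  A
    state is a vertex set L with two finite connected ends X and Y such that L
    is infinitely edge-connected once X and Y are contracted.  If X and Y can be
    separated by finitely many vertices, a smallest separator cuts L into two
    states that share a new connected end Z, while an edge between (extensions
    of) X and Y survives.  If every state of G splits in this way, iterating
    along the Stern-Brocot tree yields the Farey graph as a minor.

    Otherwise fix a state that does not split; neither does any state inside it.
    Its ends are then joined through infinitely many disjoint connected sets, and
    either the graph M between them has no finite edge cut, in which case the
    neighbours of X and Y in M are pairwise infinitely connected and give an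
    infinite clique minor, or a finite cut of M sheds a piece that is infinitely
    edge-connected together with one end and hangs off the other end.  Passing to
    a smaller state one may assume that it is always the same end that serves as
    the apex, and iteration yields [T_aleph0 * t].

    Conversely, the two graphs are not minors of each other: [T_aleph0 * t]
    contains K_{2,3} and the Farey graph does not, whereas deleting one branch
    set from a minor of [T_aleph0 * t] leaves a forest. *)

Set Implicit Arguments.
Unset Strict Implicit.
Unset Printing Implicit Defensive.

Import Order.TTheory GRing.Theory Num.Theory.
Local Open Scope classical_set_scope.

(** * Connected sets and edge cuts *)

Definition disjoint (T : Type) (A B : set T) := forall z, A z -> B z -> False.

Ltac at_point z :=
  repeat match goal with
  | H : subset _ _ |- _ => move: (H z); clear H
  | H : disjoint _ _ |- _ => move: (H z); clear H
  | H : forall _ : vertex _, _ |- _ => move: (H z); clear H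
  end;
  rewrite /setU /setI /setD /set1 /set0 /mkset /=.

Ltac set_tauto := let z := fresh "z" in rewrite /disjoint => z; at_point z; tauto.

Section Connected.
Context {G : graph}.
Implicit Types (A B C K L M N P Q S T U V W X Y Z : set G) (u v x y : G).

Definition touch A B := exists x y, [/\ A x, B y & adj x y].

(** Phrased as an induction principle along edges, so that walks never have to be handled. *)
Definition connected_set U :=
  U !=set0 /\
  forall A, (exists2 u, U u & A u) ->
    (forall u v, U u -> U v -> adj u v -> A u -> A v) -> U `<=` A.

Lemma touch_sym A B : touch A B -> touch B A.
Proof. by move=> [x [y [Ax By /adj_sym xy]]]; exists y, x. Qed.

Lemma touchS A A' B B' : A `<=` A' -> B `<=` B' -> touch A B -> touch A' B'.
Proof. by move=> sA sB [x [y [/sA ? /sB ? ?]]]; exists x, y. Qed.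

Lemma connected_set_induced U : connected_set U -> connected_graph (induced U).
Proof.
move=> [_ Uc] [x Ux] [y Uy].
have /(_ y Uy) [Uy' l] : U `<=` [set v | exists Uv : U v,
    @linked (induced U) (exist _ x Ux) (exist _ v Uv)].
  apply: Uc => [|u v Uu Uv uv [Uu' l]].
    by exists x => //=; exists Ux; exact: rt_refl.
  exists Uv; apply: rt_trans l _.
  by apply: rt_step; rewrite /= /induced_adj.
by rewrite (Prop_irrelevance Uy Uy').
Qed.

Lemma induced_connected_set U :
  U !=set0 -> connected_graph (induced U) -> connected_set U.
Proof.
move=> U0 Uc; split=> // A [u Uu Au] Acl v Uv.
have := Uc (exist _ u Uu) (exist _ v Uv).
suff H (p q : induced U) : linked p q -> A (sval p) -> A (sval q) by move/H; exact.
elim=> {p q} [[a Pa] [b Pb] /= ab Aa|//|p1 p2 p3 _ IH1 _ IH2 /IH1 /IH2 //].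
exact: Acl ab Aa.
Qed.

Lemma connected_set1 x : connected_set [set x].
Proof. by split; [exists x | move=> A [u -> Ax] _ v ->]. Qed.

Lemma connected_bigcup I (D : set I) (F : I -> set G) :
  D !=set0 -> (forall i, D i -> connected_set (F i)) ->
  (forall E : set I, (exists2 i, D i & E i) ->
     (forall i j, D i -> D j -> E i ->
        (F i `&` F j !=set0) \/ touch (F i) (F j) -> E j) -> D `<=` E) ->
  connected_set (\bigcup_(i in D) F i).
Proof.
move=> [i0 Di0] Fc Dc; split=> [|A [u [i Di Fiu] Au] Acl].
  by have [[x Fx] _] := Fc _ Di0; exists x, i0.
have sub j : D j -> (exists2 v, F j v & A v) -> F j `<=` A.
  move=> Dj FA; apply: (Fc _ Dj).2 => // v w Fv Fw; apply: Acl; by exists j.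
have /(_ _ _) DE : D `<=` [set j | F j `<=` A].
  apply: Dc => [|j k Dj Dk /= FjA [[v [Fjv Fkv]]|[v [w [Fjv Fkw vw]]]]].
  - by exists i => //; apply: sub => //; exists u.
  - by apply: sub => //; exists v => //; exact: FjA.
  - apply: sub => //; exists w => //; apply: Acl vw (FjA _ Fjv); first by exists j.
    by exists k.
by move=> v [j Dj]; exact: DE.
Qed.

Lemma connected_bigcup_star I (D : set I) (F : I -> set G) x :
  D !=set0 -> (forall i, D i -> connected_set (F i)) ->
  (forall i, D i -> F i x) -> connected_set (\bigcup_(i in D) F i).
Proof.
move=> D0 Fc Fx; apply: connected_bigcup => // E [i Di Ei] Ecl j Dj.
by apply: (Ecl i j) => //; left; exists x; split; exact: Fx.
Qed.

Lemma connected_setU A B : connected_set A -> connected_set B ->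
  (A `&` B !=set0) \/ touch A B -> connected_set (A `|` B).
Proof.
move=> Ac Bc AB.
have -> : A `|` B = \bigcup_(b in [set: bool]) (if b then A else B).
  apply/seteqP; split=> [z [Az|Bz]|z [[] _ zb]]; by [exists true|exists false|left|right].
apply: connected_bigcup => [|[] //|E [b _ Eb] Ecl c _]; first by exists true.
have BA : (B `&` A !=set0) \/ touch B A by case: AB => [|/touch_sym]; rewrite setIC; tauto.
by case: b c Eb => [] [] // Eb; [apply: (Ecl true)|apply: (Ecl false)].
Qed.

Lemma connected_setU1 A x : connected_set A -> touch A [set x] ->
  connected_set (A `|` [set x]).
Proof. by move=> Ac Ax; apply: connected_setU; [|exact: connected_set1|right]. Qed.

Lemma touch1 x y A B : A x -> B y -> adj x y -> touch A B.
Proof. by exists x, y. Qed.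

Lemma finite_connected_pair C x y : connected_set C -> C x -> C y ->
  exists Z, [/\ finite_set Z, connected_set Z, Z `<=` C, Z x & Z y].
Proof.
move=> [_ Cc] Cx Cy.
apply: (Cc [set v | exists Z, [/\ finite_set Z, connected_set Z, Z `<=` C, Z x & Z v]]).
- exists x => //; exists [set x]; split=> //; first exact: connected_set1.
  by move=> _ ->.
- move=> u v Cu Cv uv /= [Z [Zf Zc ZC Zx Zu]]; exists (Z `|` [set v]).
  split; [by rewrite finite_setU|exact/connected_setU1/(touch1 Zu)| |by left|by right].
  by move=> z [/ZC //|->].
- exact: Cy.
Qed.

Lemma finite_connected_cover C T : connected_set C -> finite_set T ->
  T !=set0 -> T `<=` C ->
  exists Z, [/\ finite_set Z, connected_set Z, T `<=` Z & Z `<=` C].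
Proof.
move=> Cc Tf [t Tt] TC.
have /choice[F FP] v : exists Z, T v ->
    [/\ finite_set Z, connected_set Z, Z `<=` C, Z t & Z v].
  have [Tv|nTv] := EM (T v); last by exists set0.
  have [Z ?] := finite_connected_pair Cc (TC _ Tt) (TC _ Tv).
  by exists Z.
exists (\bigcup_(v in T) F v); split.
- by apply: bigcup_finite Tf _ => v /FP[].
- refine (connected_bigcup_star (x := t) _ _ _) => [|v /FP[]|v /FP[]] //.
  by exists t.
- by move=> v Tv; exists v => //; have [] := FP _ Tv.
- by move=> z [v /FP[_ _ FC _ _] /FC].
Qed.

(** Otherwise the vertices reached by finite connected supersets of [X] in [K] minus [T] are closed
    under adjacency in [K], hence include a vertex of [T]. *)
Lemma connected_approach K X T : connected_set K -> connected_set X ->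
  finite_set X -> X `<=` K -> disjoint X T -> K `&` T !=set0 ->
  exists X', [/\ finite_set X', connected_set X', X `<=` X',
    X' `<=` K `\` T & touch X' T].
Proof.
move=> [_ Kc] Xc Xf XK XT [t [Kt Tt]].
apply: contrapT => no.
suff /(_ t Kt) [X' [_ _ _ X'K /X'K[_ /(_ Tt)[]]]] : K `<=` [set v | exists X',
    [/\ finite_set X', connected_set X', X `<=` X', X' `<=` K `\` T & X' v]].
refine (Kc _ _ _) => [|u v Ku Kv uv /= [X' [Xf' Xc' XX' X'K X'u]]].
  have [[x Xx] _] := Xc; exists x; first exact: XK.
  exists X; split=> // z Xz; split; first exact: XK.
  by move=> Tz; exact: XT Xz Tz.
have [Tv|nTv] := EM (T v).
  by case: no; exists X'; split=> //; exact: touch1 X'u Tv uv.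
exists (X' `|` [set v]); split; last by right.
- by rewrite finite_setU.
- exact/connected_setU1/(touch1 X'u).
- by move=> z /XX'; left.
- by move=> z [/X'K //|->].
Qed.

Definition component U x : set G :=
  [set y | exists C, [/\ connected_set C, C `<=` U, C x & C y]].

Lemma component_sub U x : component U x `<=` U.
Proof. by move=> y [C [_ CU _ /CU]]. Qed.

Lemma component_refl U x : U x -> component U x x.
Proof. by move=> Ux; exists [set x]; split=> //; [exact: connected_set1|move=> _ ->]. Qed.

Lemma component_connected U x : U x -> connected_set (component U x).
Proof.
move=> Ux.
have -> : component U x = \bigcup_(C in [set C | [/\ connected_set C, C `<=` U & C x]]) C.
  by apply/seteqP; split=> [y [C []]|y [C []]]; exists C.
refine (connected_bigcup_star (x := x) _ _ _) => [|C []|C []] //.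
by exists [set x]; split=> //; [exact: connected_set1|move=> _ ->].
Qed.

Lemma component_adj U x u v : component U x u -> U v -> adj u v ->
  component U x v.
Proof.
move=> [C [Cc CU Cx Cu]] Uv uv; exists (C `|` [set v]); split; last by right.
- exact/connected_setU1/(touch1 Cu).
- by move=> z [/CU //|->].
- by left.
Qed.

Definition few_edges A B :=
  finite_set [set e : G * G | [/\ A e.1, B e.2 & adj e.1 e.2]].

Lemma few_edges_sym A B : few_edges A B -> few_edges B A.
Proof.
move=> /(finite_image (fun e => (e.2, e.1))); apply: sub_finite_set.
by move=> [x y] /= [Bx Ay /adj_sym xy]; exists (y, x).
Qed.

Lemma few_edgesS A A' B B' : A' `<=` A -> B' `<=` B ->
  few_edges A B -> few_edges A' B'.
Proof. by move=> sA sB; apply: sub_finite_set => -[x y] /= [/sA ? /sB ? ?]. Qed.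

Lemma few_edgesUr A B B' : few_edges A B -> few_edges A B' ->
  few_edges A (B `|` B').
Proof.
move=> f1 f2; have : finite_set ([set e : G * G | [/\ A e.1, B e.2 & adj e.1 e.2]]
   `|` [set e : G * G | [/\ A e.1, B' e.2 & adj e.1 e.2]]) by rewrite finite_setU.
by apply: sub_finite_set => -[x y] /= [? [?|?] ?]; [left|right].
Qed.

Lemma few_edges0 A B : ~ touch A B -> few_edges A B.
Proof.
move=> n; apply: sub_finite_set (finite_set0 _).
by move=> -[x y] /= [Ax By xy]; case: n; exists x, y.
Qed.

Lemma few_edges_finite A B : finite_set A -> finite_set B -> few_edges A B.
Proof.
move=> Af Bf; apply: sub_finite_set (finite_setX Af Bf).
by move=> [x y] /= [? ? _]; split.
Qed.

Lemma few_edges_ends A B : few_edges A B -> exists S, [/\ finite_set S,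
  S `<=` A `|` B & forall x y, A x -> B y -> adj x y -> S x /\ S y].
Proof.
move=> f; exists (fst @` [set e : G * G | [/\ A e.1, B e.2 & adj e.1 e.2]] `|`
               snd @` [set e : G * G | [/\ A e.1, B e.2 & adj e.1 e.2]]).
split.
- by rewrite finite_setU; split; exact: finite_image.
- by move=> z [] [[x y] /= [? ? ?] <-]; [left|right].
- by move=> x y Ax By xy; split; [left|right]; exists (x, y).
Qed.

End Connected.

(** * States and their splitting *)

Lemma finite_set_minimal (T : Type) (P : set T -> Prop) :
  (exists2 S, finite_set S & P S) ->
  exists S, [/\ finite_set S, P S & forall s, S s -> ~ P (S `\ s)].
Proof.
move=> [S /(@finite_seqP {classic T})[l ->] Pl].
have [n] := ubnP (size l); elim: n l Pl => // n IH l Pl.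
rewrite ltnS => ln.
have [|no] := EM (exists2 s : T, [set` (l : seq {classic T})] s
                              & P ([set` (l : seq {classic T})] `\ s)).
  move=> [s sl Ps]; pose k : seq {classic T} := [seq x <- l | `[< x <> s :> T >]].
  apply: (IH k).
    suff <- : [set` (l : seq {classic T})] `\ s = [set` k] by [].
    apply/seteqP; split=> x /=; rewrite mem_filter.
      by move=> [-> xs]; rewrite andbT; apply/asboolP.
    by move=> /andP[/asboolP xs ->].
  apply: leq_trans ln; rewrite size_filter ltn_neqAle count_size andbT.
  rewrite -all_count; apply/negP => /allP /(_ s sl) /asboolP; exact.
exists [set` (l : seq {classic T})]; split=> //; first exact: (@finite_seq {classic T}).
by move=> s sl Ps; apply: no; exists s.
Qed.

Section States.
Context {G : graph}.
Implicit Types (A B C K L M N P Q S T U V W X Y Z : set G) (u v x y : G).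

(* With [X] contracted to a vertex, [L] is infinitely edge-connected. *)
Definition robust1 L X := forall A, A `<=` L -> A !=set0 -> disjoint A X ->
  ~ few_edges A (L `\` A).

(** [A] is the side of a cut that misses [X]; it may not divide [Y], which counts as a single
    contracted vertex. *)
Definition robust L X Y := forall A, A `<=` L -> A !=set0 -> disjoint A X ->
  (Y `<=` A \/ disjoint A Y) -> ~ few_edges A (L `\` A).

(* [X] and [Y] are finite, so contracting them turns only finitely many edges
   into parallel ones. *)
Record state L X Y : Prop := State {
  state_finl : finite_set X;
  state_finr : finite_set Y;
  state_conl : connected_set X;
  state_conr : connected_set Y;
  state_subl : X `<=` L;
  state_subr : Y `<=` L;
  state_disj : disjoint X Y;
  state_robust : robust L X Y }.

Lemma robust1_robust L X Y : robust1 L X -> robust L X Y.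
Proof. by move=> r A AL A0 AX _; exact: r. Qed.

Lemma robust_sym L X Y : Y !=set0 -> Y `<=` L -> robust L X Y -> robust L Y X.
Proof.
move=> [y Yy] YL r A AL A0 AY [XA|AX] f; last by apply: (r A) f => //; right.
apply: (r (L `\` A)).
- by move=> z [].
- by exists y; split; [exact: YL|move=> Ay; exact: AY Ay Yy].
- by move=> z [_ nA] /XA.
- by left=> z Yz; split; [exact: YL|move=> Az; exact: AY Az Yz].
- apply: few_edgesS (few_edges_sym f) => // z [Lz nLA].
  by apply: contrapT => nAz; apply: nLA.
Qed.

Lemma state_sym L X Y : state L X Y -> state L Y X.
Proof.
case=> Xf Yf Xc Yc XL YL XY r; split=> //; first by move=> z Yz /XY.
by apply: robust_sym => //; exact: Yc.1.
Qed.

Lemma state_grow L X Y X' : state L X Y -> finite_set X' -> connected_set X' ->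
  X `<=` X' -> X' `<=` L -> disjoint X' Y -> state L X' Y.
Proof.
case=> Xf Yf Xc Yc XL YL XY r Xf' Xc' XX' X'L X'Y; split=> // A AL A0 AX' YA.
by apply: r => // z Az /XX'; exact: AX'.
Qed.

(** Finitely many edges from [A] to [B] are allowed, since adjacent ends could not be separated
    otherwise. *)
Record separation L X Y S A B : Prop := Separation {
  sep_cover : L `<=` A `|` S `|` B;
  sep_subA : A `<=` L;
  sep_subS : S `<=` L;
  sep_subB : B `<=` L;
  sep_AS : disjoint A S;
  sep_BS : disjoint B S;
  sep_AB : disjoint A B;
  sep_XA : X `<=` A;
  sep_YB : Y `<=` B;
  sep_few : few_edges A B }.

Lemma separation_sym L X Y S A B :
  separation L X Y S A B -> separation L Y X S B A.
Proof.
case=> c AL SL BL AS BS AB XA YB f; split=> //; last exact: few_edges_sym.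
- set_tauto.
- set_tauto.
Qed.

(** If [A'] sent few edges to [s], then [s] and [A] minus [A'] could move to the side of [B],
    leaving a smaller separator. *)
Lemma minimal_separation_edges L X Y S A B : separation L X Y S A B ->
  (forall s, S s -> ~ exists A' B', separation L X Y (S `\ s) A' B') ->
  forall A' s, A' `<=` A -> X `<=` A' -> few_edges A' (A `\` A') -> S s ->
    ~ few_edges A' [set s].
Proof.
case=> c AL SL BL AS BS AB XA YB f Smin A' s A'A XA' f1 Ss f2.
case: (Smin s Ss); exists A', (L `\` A' `\` (S `\ s)); split=> //.
- move=> z; have [A'z|nA'z] := EM (A' z); first by left; left.
  have [Sz|nSz] := EM ((S `\ s) z); first by left; right.
  by right.
- set_tauto.
- set_tauto.
- set_tauto.
- set_tauto.
- set_tauto.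
- set_tauto.
- set_tauto.
apply: few_edgesS (few_edgesUr f1 (few_edgesUr f2 (few_edgesS A'A (fun z => id) f))) => //.
move=> z; have [Az|nAz] := EM (A z); have [<-|zs] := EM (z = s).
all: clear f f1 f2 Smin; at_point z; tauto.
Qed.

(** For a finite cut [Q], the preceding lemma applied to [A] minus [Q] shows that [Q] misses [S]; so
    [Q] lies in [A] and is a finite cut of [L] too. *)
Lemma minimal_separation_robust L X Y S A B : state L X Y ->
  separation L X Y S A B ->
  (forall s, S s -> ~ exists A' B', separation L X Y (S `\ s) A' B') ->
  robust1 (A `|` S) X.
Proof.
move=> st sp Smin Q QAS Q0 QX f.
have key := minimal_separation_edges sp Smin.
case: sp => c AL SL BL AS BS AB XA YB fAB.
have QS s : Q s -> S s -> False.
  move=> Qs Ss; refine (key (A `\` Q) s _ _ _ Ss _).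
  - by clear key; set_tauto.
  - by clear key; set_tauto.
  - apply: few_edgesS (few_edges_sym f) => z.
      by move=> [Az nQz]; split=> //; left.
    by move=> [Az nAQ]; apply: contrapT => nQz; apply: nAQ.
  - apply: few_edgesS (few_edges_sym f) => z; last by move=> ->.
    by move=> [Az nQz]; split=> //; left.
apply: (state_robust st (A := Q)) => //.
- by clear st Smin f fAB key; set_tauto.
- by right; clear st Smin f fAB key; set_tauto.
apply: few_edgesS (few_edgesUr f (few_edgesS (A' := Q) _ (fun z => id) fAB)) => //.
  by clear st Smin f fAB key; set_tauto.
by clear st Smin f fAB key; set_tauto.
Qed.

Lemma robust1_component L X x : X `<=` L -> robust1 L X -> (L `\` X) x ->
  robust1 (component (L `\` X) x `|` X) X.
Proof.
move=> XL r LXx Q QC Q0 QX f.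
have sC := @component_sub _ (L `\` X) x.
apply: (r Q) => //; first set_tauto.
apply: few_edgesS (few_edgesUr f (few_edges0 (A := Q)
  (B := L `\` X `\` component (L `\` X) x) _)) => //.
- move=> z [Lz nQ]; have [Cz|nCz] := EM ((component (L `\` X) x `|` X) z).
    by left.
  by right; split; [split=> // Xz; apply: nCz; right|move=> Cz; apply: nCz; left].
- move=> [u [v [Qu [LXv nCv] uv]]]; apply: nCv; apply: component_adj LXv uv.
  by case: (QC _ Qu) => // Xu; case: (QX _ Qu Xu).
Qed.

(* A separator with as few vertices as possible sends infinitely many edges to
   every candidate for either side, so both sides together with the separator
   are infinitely edge-connected again. *)
Lemma state_split L X Y S : state L X Y -> finite_set S ->
  (exists A B, separation L X Y S A B) ->
  exists L1 L2 Z, [/\ state L1 X Z, state L2 Z Y, L1 `|` L2 `<=` L,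
    L1 `&` L2 `<=` Z & disjoint Y L1 /\ disjoint X L2].
Proof.
move=> st Sf sp.
have [{Sf sp}S [Sf [A [B sp]] Smin]] :
    exists S, [/\ finite_set S, exists A B, separation L X Y S A B
     & forall s, S s -> ~ exists A B, separation L X Y (S `\ s) A B].
  by apply: finite_set_minimal; exists S.
have rA := minimal_separation_robust st sp Smin.
have rB : robust1 (B `|` S) Y.
  apply: minimal_separation_robust (state_sym st) (separation_sym sp) _.
  by move=> s Ss [A' [B' /separation_sym sp']]; apply: (Smin s Ss); exists B', A'.
clear Smin.
case: sp => c AL SL BL AS BS AB XA YB fAB.
case: st => Xf Yf Xc Yc XL YL XY r.
(* With [S] empty, [B] would be a finite cut of [L] around [Y]. *)
have [s0 Ss0] : S !=set0.
  apply: contrapT => S0; apply: (r B) => //.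
  - by have [[y Yy] _] := Yc; exists y; exact: YB.
  - set_tauto.
  - by left.
  - apply: few_edgesS (few_edges_sym fAB) => // z.
    have nSz : ~ S z by move=> Sz; apply: S0; exists z.
    clear r S0; at_point z; tauto.
pose C := component ((A `|` S) `\` X) s0.
pose D := component ((B `|` S) `\` Y) s0.
have ASs : ((A `|` S) `\` X) s0 by split; [right|move=> /XA As; exact: AS As Ss0].
have BSs : ((B `|` S) `\` Y) s0 by split; [right|move=> /YB Bs; exact: BS Bs Ss0].
have sC : C `<=` (A `|` S) `\` X by exact: component_sub.
have sD : D `<=` (B `|` S) `\` Y by exact: component_sub.
have Cs : C s0 by exact: component_refl.
have Ds : D s0 by exact: component_refl.
have Cc : connected_set C by exact: component_connected.
have r1 : robust1 (C `|` X) X.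
  by apply: robust1_component => // z /XA; left.
have r2 : robust1 (D `|` Y) Y.
  by apply: robust1_component => // z /YB; left.
clearbody C D; clear r rA rB ASs BSs.
(* [C] and [D] meet only in the finite set [S]; once [Z] covers their intersection, the new states
   overlap inside [Z] only. *)
have [Z [Zf Zc CDZ ZC]] : exists Z, [/\ finite_set Z, connected_set Z,
    C `&` D `<=` Z & Z `<=` C].
  apply: finite_connected_cover.
  - exact: Cc.
  - by apply: sub_finite_set Sf; clear r1 r2; set_tauto.
  - by exists s0.
  - by move=> z [].
exists (C `|` X), (D `|` Y `|` Z), Z.
have ZD : (Z `&` D) s0 by split=> //; apply: CDZ.
have r3 : robust (D `|` Y `|` Z) Z Y.
  move=> Q QL Q0 QZ [YQ|QY] f.
    apply: (r2 ((D `|` Y) `\` Q)).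
    - by move=> z [].
    - by exists s0; split; [by left|move=> Qs; apply: QZ Qs ZD.1].
    - by move=> z [_ nQ] /YQ.
    - apply: few_edgesS (few_edges_sym f) => z; first by clear r1 r2; at_point z; tauto.
      by move=> [DYz nQz]; apply: contrapT => nQ; apply: nQz.
  apply: (r2 Q) => //.
    move=> z Qz; have nZ := QZ z Qz; clear r1 r2; at_point z; tauto.
  by apply: few_edgesS f => // z [DYz nQ]; split=> //; left.
split.
- split=> //; try (clear r1 r2 r3; set_tauto); exact: robust1_robust.
- split=> //; try (clear r1 r2 r3; set_tauto).
- clear r1 r2 r3; set_tauto.
- clear r1 r2 r3; set_tauto.
- split; clear r1 r2 r3; set_tauto.
Qed.

(** The side of [X] is what [X] reaches off [S]. Without a bridge, its only edges to the other side
    join [X] to [Y], and both are finite. *)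
Lemma separation_of_no_bridge L X Y S : state L X Y -> finite_set S ->
  ~ (exists Q, [/\ connected_set Q, Q `<=` L `\` (X `|` Y) `\` S, touch Q X
                 & touch Q Y]) ->
  exists A B, separation L X Y (S `&` (L `\` (X `|` Y))) A B.
Proof.
case=> Xf Yf Xc Yc XL YL XY r Sf no.
pose R := L `\` (X `|` Y) `\` S.
pose A := X `|` [set v | exists Q, [/\ connected_set Q, Q `<=` R, Q v & touch Q X]].
have AR z : A z -> X z \/ R z by move=> [?|[Q [_ QR /QR ? _]]]; [left|right].
exists A, (L `\` A `\` (S `&` (L `\` (X `|` Y)))); rewrite -/R; split.
- move=> z Lz; have [Az|nAz] := EM (A z); first by left; left.
  by have [?|?] := EM ((S `&` (L `\` (X `|` Y))) z); [left; right|right].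
- by move=> z /AR[/XL|[[]]].
- by move=> z [_ []].
- by move=> z [[]].
- by move=> z /AR[Xz|[_ nSz]] [Sz [_ nXY]]; [apply: nXY; left|].
- by move=> z [].
- by move=> z Az [[]].
- by move=> z; left.
- move=> z Yz; split; last by move=> [_ [_ nXY]]; apply: nXY; right.
  by split; [exact: YL|move=> /AR[/XY/(_ Yz)[]|[[_ nXY] _]]; apply: nXY; right].
- apply: sub_finite_set (few_edges_finite Xf Yf) => -[a b] /= [Aa Bb ab].
  have [[Lb nAb] nSb] := Bb.
  have nXb : ~ X b by move=> Xb; apply: nAb; left.
  have RYb : Y b \/ R b.
    have [Yb|nYb] := EM (Y b); [by left|right; split; first by split=> //; case].
    by move=> Sb; apply: nSb; split=> //; split=> //; case.
  case: Aa => [Xa|[Q [Qc QR Qa QX]]].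
    split=> //; case: RYb => // Rb; case: nAb; right; exists [set b]; split=> //.
    - exact: connected_set1.
    - by move=> _ ->.
    - by exists b, a; split=> //; exact: adj_sym.
  case: RYb => [Yb|Rb].
    by case: no; exists Q; split=> //; exists a, b.
  case: nAb; right; exists (Q `|` [set b]); split; last first.
  - by apply: touchS QX => // z; left.
  - by right.
  - by move=> z [/QR|->].
  - exact/connected_setU1/(touch1 Qa).
Qed.

Lemma bridge_or_split L X Y S : state L X Y -> finite_set S ->
  (exists Q, [/\ connected_set Q, Q `<=` L `\` (X `|` Y) `\` S, touch Q X
               & touch Q Y]) \/
  exists L1 L2 Z, [/\ state L1 X Z, state L2 Z Y, L1 `|` L2 `<=` L,
    L1 `&` L2 `<=` Z & disjoint Y L1 /\ disjoint X L2].
Proof.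
move=> st Sf; have [|no] := EM (exists Q, [/\ connected_set Q,
  Q `<=` L `\` (X `|` Y) `\` S, touch Q X & touch Q Y]); [by left|right].
apply: state_split st _ (separation_of_no_bridge st Sf no).
exact: finite_setIl.
Qed.

End States.

(** * Linked states and growth *)

Section Moves.
Context {G : graph}.
Implicit Types (A B C J K L M N P Q S T U V W X Y Z : set G) (u v x y : G).

(* Contracting [U] and [W] turns the ends of [L] into those of [L']. *)
Record linkage L X Y L' X' Y' U W : Prop := Linkage {
  link_conl : connected_set U;
  link_conr : connected_set W;
  link_disj : disjoint U W;
  link_subl : X `<=` U;
  link_subr : Y `<=` W;
  link_endl : X' `<=` U;
  link_endr : Y' `<=` W;
  link_Ul : U `<=` L;
  link_Wl : W `<=` L;
  link_sub : L' `<=` L;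
  link_meetl : U `&` L' `<=` X';
  link_meetr : W `&` L' `<=` Y' }.

(** One Stern-Brocot subdivision: [U] and [W] extend the old ends and carry the edge between them;
    [Z] is the end inserted in the middle. *)
Record splitting L X Y U W Z L1 L2 X1 Y2 : Prop := Splitting {
  split_conl : connected_set U;
  split_conr : connected_set W;
  split_disj : disjoint U W;
  split_touch : touch U W;
  split_subl : X `<=` U;
  split_subr : Y `<=` W;
  split_Ul : U `<=` L;
  split_Wl : W `<=` L;
  split_sub1 : L1 `<=` L;
  split_sub2 : L2 `<=` L;
  split_end1 : X1 `<=` U;
  split_end2 : Y2 `<=` W;
  split_meet1 : U `&` L1 `<=` X1;
  split_meet2 : W `&` L2 `<=` Y2;
  split_out2 : disjoint U L2;
  split_out1 : disjoint W L1;
  split_mid : L1 `&` L2 `<=` Z;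
  split_state1 : state L1 X1 Z;
  split_state2 : state L2 Z Y2 }.

Definition splits L X Y :=
  exists U W Z L1 L2 X1 Y2, splitting L X Y U W Z L1 L2 X1 Y2.

(* [(L', X', Y')] continues [(L, X, Y)], while [(K, V, T)] is a new child: it
   shares only the end [T] with the side of [Y], and hangs off the side of [X]
   by an edge. *)
Record growth L X Y U W L' X' Y' K V T : Prop := Growth {
  grow_conl : connected_set U;
  grow_conr : connected_set W;
  grow_disj : disjoint U W;
  grow_touch : touch U W;
  grow_subl : X `<=` U;
  grow_subr : Y `<=` W;
  grow_Ul : U `<=` L;
  grow_Wl : W `<=` L;
  grow_sub : L' `<=` L;
  grow_endl : X' `<=` U;
  grow_endr : Y' `<=` W;
  grow_meetl : U `&` L' `<=` X';
  grow_meetr : W `&` L' `<=` Y';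
  grow_child : K `<=` L;
  grow_childl : disjoint U K;
  grow_childend : T `<=` W;
  grow_childr : W `&` K `<=` T;
  grow_apart : L' `&` K `<=` W;
  grow_hang : touch U V;
  grow_state : state L' X' Y';
  grow_childstate : state K V T }.

Definition grows L X Y :=
  exists U W L' X' Y' K V T, growth L X Y U W L' X' Y' K V T.

Lemma linkage_sym L X Y L' X' Y' U W :
  linkage L X Y L' X' Y' U W -> linkage L Y X L' Y' X' W U.
Proof. by case=> *; split=> //; move=> z Wz Uz; eauto. Qed.

Lemma linkage_refl L X Y : state L X Y -> linkage L X Y L X Y X Y.
Proof. by case=> *; split=> // z []. Qed.

Lemma linkage_setU L X Y L' X' Y' U W U' W' : state L' X' Y' ->
  linkage L X Y L' X' Y' U W -> X' `<=` U' -> Y' `<=` W' ->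
  connected_set U' -> connected_set W' ->
  connected_set (U `|` U') /\ connected_set (W `|` W').
Proof.
case=> _ _ [[x0 Xx0] _] [[y0 Yy0] _] _ _ _ _ lk XU YW Uc Wc.
split; apply: connected_setU => //.
- exact: link_conl lk.
- by left; exists x0; split; [exact: (link_endl lk)|exact: XU].
- exact: link_conr lk.
- by left; exists y0; split; [exact: (link_endr lk)|exact: YW].
Qed.

Lemma linkage_trans L X Y L' X' Y' L'' X'' Y'' U W U' W' : state L' X' Y' ->
  linkage L X Y L' X' Y' U W -> linkage L' X' Y' L'' X'' Y'' U' W' ->
  linkage L X Y L'' X'' Y'' (U `|` U') (W `|` W').
Proof.
move=> st lk lk'.
have [c1 c2] := linkage_setU st lk (link_subl lk') (link_subr lk')
  (link_conl lk') (link_conr lk').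
case: lk lk' => _ _ d a1 a2 a3 a4 a5 a6 a7 a8 a9 [_ _ d' b1 b2 b3 b4 b5 b6 b7 b8 b9].
by split=> //; clear c1 c2; set_tauto.
Qed.

Lemma splits_sym L X Y : splits L X Y -> splits L Y X.
Proof.
move=> [U [W [Z [L1 [L2 [X1 [Y2 [cU cW d t]]]]]]]] *.
exists W, U, Z, L2, L1, Y2, X1; split=> //.
- by move=> z Wz /d; exact.
- exact: touch_sym.
- by rewrite setIC.
- exact: state_sym.
- exact: state_sym.
Qed.

(** Used contrapositively: a state linked to an unsplittable one is unsplittable. *)
Lemma splits_linkage L X Y L' X' Y' U W : state L' X' Y' ->
  linkage L X Y L' X' Y' U W -> splits L' X' Y' -> splits L X Y.
Proof.
move=> st lk [U' [W' [Z [L1 [L2 [X1 [Y2 sp]]]]]]].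
have [c1 c2] := linkage_setU st lk (split_subl sp) (split_subr sp)
  (split_conl sp) (split_conr sp).
exists (U `|` U'), (W `|` W'), Z, L1, L2, X1, Y2.
case: sp => _ _ b1 b2 b3 b4 b5 b6 b7 b8 b9 b10 b11 b12 b13 b14 b15 s1 s2.
case: lk => _ _ d a1 a2 a3 a4 a5 a6 a7 a8 a9.
split=> //; clear c1 c2 s1 s2 st; try set_tauto.
by apply: touchS b2 => z; right.
Qed.

Lemma grows_linkage L X Y L' X' Y' U W : state L' X' Y' ->
  linkage L X Y L' X' Y' U W -> grows L' X' Y' -> grows L X Y.
Proof.
move=> st lk [U' [W' [M [X1 [Y1 [K [V [T g]]]]]]]].
have [c1 c2] := linkage_setU st lk (grow_subl g) (grow_subr g)
  (grow_conl g) (grow_conr g).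
exists (U `|` U'), (W `|` W'), M, X1, Y1, K, V, T.
case: g => _ _ b1 b2 b3 b4 b5 b6 b7 b8 b9 b10 b11 b12 b13 b14 b15 b16 b17 s1 s2.
case: lk => _ _ d a1 a2 a3 a4 a5 a6 a7 a8 a9.
split=> //; clear c1 c2 s1 s2 st; try set_tauto.
  by apply: touchS b2 => z; right.
by apply: touchS b17 => // z; right.
Qed.

Lemma growth_linkage L X Y U W L' X' Y' K V T :
  growth L X Y U W L' X' Y' K V T -> linkage L X Y L' X' Y' U W.
Proof. by case=> *; split. Qed.

(** As [V] touches [U], it can be absorbed on that side, and the growth can be repeated inside the
    child. *)
Lemma growth_child_linkage L X Y U W L' X' Y' K V T :
  growth L X Y U W L' X' Y' K V T -> linkage L X Y K V T (U `|` V) W.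
Proof.
move=> g; have st := grow_childstate g; have VK := state_subl st.
have VT := state_disj st.
split; try by case: g => *; clear st; set_tauto.
- apply: connected_setU; [exact: grow_conl g|exact: state_conl st|].
  by right; exact: grow_hang g.
- exact: grow_conr g.
Qed.

Definition thick X Y M := forall S, finite_set S -> exists Q,
  [/\ connected_set Q, Q `<=` M `\` S, touch Q X & touch Q Y].

Definition full X Y M := forall v, M v -> exists Q,
  [/\ connected_set Q, Q `<=` M, Q v, touch Q X & touch Q Y].

Definition full_part X Y M : set G := [set v | exists Q,
  [/\ connected_set Q, Q `<=` M, Q v, touch Q X & touch Q Y]].

Lemma full_part_sub X Y M : full_part X Y M `<=` M.
Proof. by move=> v [Q [_ QM /QM]]. Qed.

Lemma full_part_full X Y M : full X Y (full_part X Y M).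
Proof. by move=> v [Q [Qc QM Qv QX QY]]; exists Q; split=> // z Qz; exists Q. Qed.

Lemma full_part_thick X Y M : thick X Y M -> thick X Y (full_part X Y M).
Proof.
move=> th S /th [Q [Qc QM QX QY]]; exists Q; split=> // z Qz.
split; last by have [] := QM _ Qz.
by exists Q; split=> // t /QM[].
Qed.

Lemma full_part_few X Y M : few_edges (full_part X Y M) (M `\` full_part X Y M).
Proof.
apply: few_edges0 => -[u [v [[Q [Qc QM Qu QX QY]] [Mv nv] uv]]]; apply: nv.
exists (Q `|` [set v]); split.
- exact/connected_setU1/(touch1 Qu).
- by move=> z [/QM //|->].
- by right.
- by apply: touchS QX => // z; left.
- by apply: touchS QY => // z; left.
Qed.

Lemma thick_sym X Y M : thick X Y M -> thick Y X M.
Proof. by move=> th S /th[Q [? ? ? ?]]; exists Q. Qed.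

Lemma full_sym X Y M : full X Y M -> full Y X M.
Proof. by move=> th v /th[Q [? ? ? ? ?]]; exists Q. Qed.

(** A connecting set that avoids the ends of the edges between [A] and [B] lies in [A] or in [B]. *)
Lemma thick_setU X Y A B : few_edges A B -> thick X Y (A `|` B) ->
  thick X Y A \/ thick X Y B.
Proof.
move=> f th; have [tA|/existsNP[SA /not_implyP[SAf nA]]] := EM (thick X Y A).
  by left.
right=> SB SBf; have [S [Sf _ Sends]] := few_edges_ends f.
have [|Q [Qc QAB QX QY]] := th (SA `|` SB `|` S).
  by rewrite !finite_setU.
exists Q; split=> //.
have QA q : Q q -> A q -> Q `<=` A.
  move=> Qq Aq; apply: Qc.2; first by exists q.
  move=> u v Qu Qv uv Au; have [[//|Bv] _] := QAB _ Qv.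
  by have [_ []] := QAB _ Qu; right; have [] := Sends u v Au Bv uv.
move=> q Qq; have [[Aq|Bq] nS] := QAB _ Qq; last first.
  by split=> // SBq; apply: nS; left; right.
case: nA; exists Q; split=> // z Qz; split; first exact: QA Qq Aq _ Qz.
by move=> SAz; have [_ []] := QAB _ Qz; left; left.
Qed.

(* [P] takes over as the continuation and a component of [J], which carries
   infinitely many edges to [Y] however it is cut, becomes the child. *)
Lemma grows_of_part L X Y M P J :
  let N := L `\` (X `|` Y) in
  state L X Y -> touch X Y -> M `<=` N -> full X Y M -> P `<=` M ->
  thick X Y P -> few_edges P (N `\` P) -> J `<=` M `\` P -> J !=set0 ->
  few_edges J (N `\` J) ->
  (forall A, A `<=` J -> A !=set0 -> few_edges A (N `\` A) ->
     ~ few_edges A Y) ->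
  grows L X Y.
Proof.
move=> N st XYt MN Mf PM Pt Pfew JM [j Jj] Jfew JY.
pose K := component J j.
have KJ : K `<=` J by exact: component_sub.
have Kj : K j by exact: component_refl.
have Kc : connected_set K by exact: component_connected.
have Kfew : few_edges K (J `\` K).
  apply: few_edges0 => -[u [v [Ku [Jv nKv] uv]]]; apply: nKv.
  exact: component_adj uv.
clearbody K.
have r := state_robust st.
case: (st) => Xf Yf Xc Yc XL YL XY _.
have [Q [Qc QM Qj QX QY]] := Mf j (JM _ Jj).1.
(* [X] is extended along a connecting set through [j] until it touches [K]; the vertex [v] of
   contact becomes the hanging end of the child. *)
have [X' [Xf' Xc' XX' X'Q X'K]] : exists X', [/\ finite_set X',
    connected_set X', X `<=` X', X' `<=` (Q `|` X) `\` K & touch X' K].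
  refine (connected_approach _ Xc Xf _ _ _).
  - by apply: connected_setU => //; right.
  - by move=> z; right.
  - by move=> z Xz /KJ/JM[/MN[_]] nXY; case: nXY; left.
  - by exists j; split=> //; left.
have [u [v [X'u Kv uv]]] := X'K.
have NL z : N z -> L z by case.
have NX z : N z -> X z -> False by move=> [_ nXY] Xz; apply: nXY; left.
have NY z : N z -> Y z -> False by move=> [_ nXY] Yz; apply: nXY; right.
have LN z : L z -> N z \/ X z \/ Y z.
  by move=> Lz; have [[]|nXY] := EM ((X `|` Y) z); [right; left|right; right|left].
have rK : robust1 (K `|` Y) Y.
  move=> A AK A0 AY f; apply: (JY A) => //.
  - by clear r Jfew JY Pfew Kfew f st; set_tauto.
  - apply: few_edgesS (few_edgesUr f (few_edgesUr
        (few_edgesS (A' := A) _ (fun z => id) Kfew)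
        (few_edgesS (A' := A) _ (fun z => id) Jfew))) => //.
    + move=> z [Nz nAz]; have [Jz|nJz] := EM (J z); last by right; right.
      have [Kz|nKz] := EM (K z); last by right; left.
      by left; split=> //; left.
    + by clear r Jfew JY Pfew Kfew f st; set_tauto.
    + by clear r Jfew JY Pfew Kfew f st; set_tauto.
  - apply: few_edgesS f => // z Yz; split; first by right.
    by move=> Az; exact: AY Az Yz.
have X'Y : disjoint X' Y.
  by clear r Jfew JY Pfew Kfew rK st; clearbody N; set_tauto.
have rL : robust (P `|` X' `|` Y) X' Y.
  move=> A AL A0 AX' [YA|AY] f.
    (* A connecting set off the ends of the cut edges starts next to [X], outside [A], and can never
       enter [A], which contains its target [Y]. *)
    have [S [Sf _ Sends]] := few_edges_ends f.
    have [B [Bc BP [b [x [Bb Xx bx]]] [c [y [Bc' Yy cy]]]]] := Pt S Sf.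
    have nA : B `<=` ~` A.
      apply: Bc.2 => [|z t Bz Bt zt nAz At].
        exists b => // Ab; have [_] := BP _ Bb; apply.
        have [|//] := Sends b x Ab _ bx.
        split; first by left; right; exact: XX'.
        by move=> Ax; exact: AX' Ax (XX' _ Xx).
      have [_] := BP _ Bt; apply.
      have [|//] := Sends t z At _ (adj_sym zt).
      by split=> //; left; left; have [] := BP _ Bz.
    have [_] := BP _ Bc'; apply.
    have [|//] := Sends y c (YA _ Yy) _ (adj_sym cy).
    by split; [left; left; have [] := BP _ Bc'|exact: nA].
  have AP : A `<=` P.
    move=> z Az; have := AX' _ Az; have := AY _ Az; have := AL _ Az.
    by rewrite /setU /=; tauto.
  apply: (r A) => //.
  - by move=> z /AP/PM/MN[].
  - by move=> z Az /XX'; exact: AX'.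
  - by right.
  - apply: few_edgesS (few_edgesUr f (few_edgesS AP (fun z => id) Pfew)) => //.
    move=> z [Lz nAz]; case: (LN _ Lz) => [Nz|[Xz|Yz]].
    + have [Pz|nPz] := EM (P z); last by right.
      by left; split=> //; left; left.
    + by left; split=> //; left; right; exact: XX'.
    + by left; split=> //; right.
have X'L : X' `<=` L.
  by clear r Jfew JY Pfew Kfew rK rL st; clearbody N; set_tauto.
have X'Kd : disjoint X' K.
  by clear r Jfew JY Pfew Kfew rK rL st; clearbody N; set_tauto.
exists X', Y, (P `|` X' `|` Y), X', Y, (K `|` Y), [set v], Y.
clear r Jfew JY Pfew Kfew.
split=> //; try by (clear rK rL st; clearbody N; set_tauto).
- exact: touchS XYt.
- by exists u, v.
- split=> //; by (clear rK rL st; clearbody N; set_tauto).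
- apply: state_sym; split=> //; first exact: connected_set1.
  + by move=> z ->; left.
  + move=> z Yz zv; rewrite zv in Yz.
    by apply: (NY v) => //; apply: MN; have [] := JM _ (KJ _ Kv).
  + exact: robust1_robust.
Qed.

End Moves.

(** * Splitting, cliques or growth *)

Section Dichotomy.
Context {G : graph}.
Implicit Types (A B C J K L M N P Q S T U V W X Y Z : set G) (u v x y : G).

Definition has_infinite_clique_minor := exists V : nat -> set G,
  [/\ forall n, connected_set (V n),
      forall m n, (m < n)%N -> disjoint (V m) (V n)
    & forall m n, (m < n)%N -> touch (V n) (V m)].

(** A fresh vertex [a] is the centre of a star of connections to the vertices of [B] in [D] and to a
    fresh [b0], kept as contact for later branch sets. *)
Lemma clique_step (A B D : set G) :
  (forall S, finite_set S -> exists2 a, A a & ~ S a) ->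
  (forall S, finite_set S -> exists2 b, B b & ~ S b) ->
  (forall a b S, A a -> B b -> a <> b -> finite_set S -> exists Q,
    [/\ connected_set Q, disjoint Q S, touch Q [set a] & touch Q [set b]]) ->
  finite_set D ->
  exists V, [/\ finite_set V, connected_set V, disjoint V D, V `&` B !=set0
    & forall b, D b -> B b -> touch V [set b]].
Proof.
move=> Ainf Binf AB Df.
have [a Aa nDa] := Ainf D Df.
have [|b0 Bb0 nDb0] := Binf (D `|` [set a]); first by rewrite finite_setU.
have ab b : (D `|` [set b0]) b -> a <> b.
  by move=> [Db e|-> e]; [apply: nDa; rewrite e|apply: nDb0; right].
have /choice[F FP] b : exists Q, B b -> (D `|` [set b0]) b ->
    [/\ finite_set Q, connected_set Q, disjoint Q D, Q a & touch Q [set b]].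
  have [Bb|nBb] := EM (B b); last by exists set0.
  have [Db|nDb] := EM ((D `|` [set b0]) b); last by exists set0.
  have [Q [Qc QD [q [_ [Qq -> qa]]] [r [_ [Qr -> rb]]]]] := AB a b D Aa Bb (ab b Db) Df.
  have [Z [Zf Zc ZQ Zq Zr]] := finite_connected_pair Qc Qq Qr.
  exists (Z `|` [set a]) => _ _; split.
  - by rewrite finite_setU.
  - exact/connected_setU1/(touch1 Zq).
  - by move=> z [/ZQ/QD//|->].
  - by right.
  - by exists r, b; split=> //; left.
pose I := (D `|` [set b0]) `&` B.
have Ib0 : I b0 by split=> //; right.
have [_ c0 _ Fa0 [q [_ [Fq -> qb]]]] := FP b0 Bb0 Ib0.1.
exists ((\bigcup_(b in I) F b) `|` [set b0]); split.
- rewrite finite_setU; split=> //; apply: bigcup_finite => [|b [Db Bb]].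
    by apply: finite_setIl; rewrite finite_setU.
  by have [] := FP b Bb Db.
- apply: connected_setU1; last by exists q, b0; split=> //; exists b0.
  apply: (connected_bigcup_star (x := a)); first by exists b0.
  + by move=> b [Db Bb]; have [] := FP b Bb Db.
  + by move=> b [Db Bb]; have [] := FP b Bb Db.
- move=> z [[b [Db Bb] Fz]|-> Dz]; last by apply: nDb0; left.
  by have [_ _ d _ _] := FP b Bb Db; exact: d.
- by exists b0; split=> //; right.
- move=> b Db Bb; have Ib : I b by split=> //; left.
  have [_ _ _ _ t] := FP b Bb Ib.1.
  by apply: touchS t => // z Fz; left; exists b.
Qed.

(** Iterates [clique_step] on the union [D n] of the first [n] branch sets, each of which contains a
    vertex of [B] to be touched. *)
Lemma clique_of_bipartite (A B : set G) :
  (forall S, finite_set S -> exists2 a, A a & ~ S a) ->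
  (forall S, finite_set S -> exists2 b, B b & ~ S b) ->
  (forall a b S, A a -> B b -> a <> b -> finite_set S -> exists Q,
    [/\ connected_set Q, disjoint Q S, touch Q [set a] & touch Q [set b]]) ->
  has_infinite_clique_minor.
Proof.
move=> Ainf Binf AB.
have /choice[F FP] (D : set G) : exists V, finite_set D ->
    [/\ finite_set V, connected_set V, disjoint V D, V `&` B !=set0
      & forall b, D b -> B b -> touch V [set b]].
  have [Df|nDf] := EM (finite_set D); last by exists set0.
  by have [V ?] := clique_step Ainf Binf AB Df; exists V.
pose D := fix D n := if n is n'.+1 then D n' `|` F (D n') else set0.
have Df n : finite_set (D n).
  elim: n => [|n IH] /=; first exact: finite_set0.
  by rewrite finite_setU; split=> //; have [] := FP _ IH.
have FD m n : (m < n)%N -> F (D m) `<=` D n.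
  elim: n => // n IH; rewrite ltnS leq_eqVlt => /orP[/eqP->|mn] z Fz; first by right.
  by left; exact: IH mn _ Fz.
exists (fun n => F (D n)); split.
- by move=> n; have [] := FP _ (Df n).
- move=> m n mn z Fm Fn; have [_ _ d _ _] := FP _ (Df n).
  by apply: d Fn _; exact: FD Fm.
- move=> m n mn; have [_ _ _ [b [Fb Bb]] _] := FP _ (Df m).
  have [_ _ _ _ t] := FP _ (Df n).
  by apply: touchS (t b (FD _ _ mn _ Fb) Bb) => // z ->.
Qed.

Lemma thick_of_unsplit L X Y : state L X Y -> touch X Y -> ~ splits L X Y ->
  thick X Y (L `\` (X `|` Y)).
Proof.
move=> st XYt ns S Sf.
have [//|[L1 [L2 [Z [s1 s2 L12 LZ [YL XL]]]]]] := bridge_or_split st Sf.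
case: ns; exists X, Y, Z, L1, L2, X, Y.
split=> //; try exact: state_conl st; try exact: state_conr st;
  try exact: state_disj st; try exact: state_subl st; try exact: state_subr st.
- by move=> z Lz; apply: L12; left.
- by move=> z Lz; apply: L12; right.
Qed.

(* If [M] cannot be cut, then every neighbour of [X] and every neighbour of [Y]
   in [M] are infinitely connected to each other in [M]: a finite separator
   would split [M] between them, and [X] and [Y] provide the edge that makes
   this a splitting of [L]. *)
Lemma clique_of_uncut L X Y M : state L X Y -> touch X Y -> ~ splits L X Y ->
  M `<=` L `\` (X `|` Y) -> thick X Y M ->
  (forall A, A `<=` M -> A !=set0 -> M `\` A !=set0 -> ~ few_edges A (M `\` A)) ->
  has_infinite_clique_minor.
Proof.
move=> st XYt ns MN Mt Mu.
apply: (@clique_of_bipartite [set a | M a /\ touch X [set a]]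
                             [set b | M b /\ touch Y [set b]]).
- move=> S /Mt[Q [_ QM [a [x [Qa Xx ax]]] _]]; have [Ma nSa] := QM _ Qa.
  by exists a => //; split=> //; exists x, a; split=> //; exact: adj_sym.
- move=> S /Mt[Q [_ QM _ [a [x [Qa Xx ax]]]]]; have [Ma nSa] := QM _ Qa.
  by exists a => //; split=> //; exists x, a; split=> //; exact: adj_sym.
move=> a b S [Ma Xa] [Mb Yb] ab Sf.
have sM : state M [set a] [set b].
  split=> //.
  - exact: connected_set1.
  - exact: connected_set1.
  - by move=> _ ->.
  - by move=> _ ->.
  - by move=> _ -> /ab.
  - move=> A AM A0 Aa _; apply: Mu => //.
    by exists a; split=> // Aa'; exact: Aa Aa' _.
have [[Q [Qc QM Qa Qb]]|[L1 [L2 [Z [s1 s2 L12 LZ [YL XL]]]]]] := bridge_or_split sM Sf.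
  by exists Q; split=> // z /QM[].
have [nXa nYa] : ~ X a /\ ~ Y a.
  by have [_ nXY] := MN _ Ma; split=> ?; apply: nXY; [left|right].
have [nXb nYb] : ~ X b /\ ~ Y b.
  by have [_ nXY] := MN _ Mb; split=> ?; apply: nXY; [left|right].
case: ns; exists (X `|` [set a]), (Y `|` [set b]), Z, L1, L2, [set a], [set b].
have La := state_subl s1; have Lb := state_subr s2.
case: st => Xf Yf Xc Yc XL' YL' XY r; clear Mu Mt Sf sM.
split=> //; try by (clear r Xa Yb XYt; set_tauto).
- exact: connected_setU1.
- exact: connected_setU1.
- by apply: touchS XYt => z; left.
Qed.

(** The part of [M] outside the full part of [P] supplies the child. If a piece of it, cut off by
    finitely many edges, has few edges to [X], robustness gives its own such pieces infinitely many
    edges to [Y]; if there is none, [X] takes the place of [Y]. *)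
Lemma grows_of_cut L X Y M P : let N := L `\` (X `|` Y) in
  state L X Y -> touch X Y -> M `<=` N -> full X Y M -> few_edges M (N `\` M) ->
  P `<=` M -> M `\` P !=set0 -> few_edges P (M `\` P) -> thick X Y P ->
  grows L X Y \/ grows L Y X.
Proof.
move=> N st XYt MN Mf Mfew PM [j [Mj nPj]] Pfew Pt.
pose P' := full_part X Y P.
have P'P : P' `<=` P by exact: full_part_sub.
have P't : thick X Y P' by exact: full_part_thick.
have P'M : P' `<=` M by move=> z /P'P/PM.
have P'few : few_edges P' (N `\` P').
  apply: few_edgesS (few_edgesUr (@full_part_few _ X Y P) (few_edgesUr
    (few_edgesS P'P (fun z => id) Pfew) (few_edgesS P'M (fun z => id) Mfew))) => //.
  move=> z [Nz nP'z]; have [Pz|nPz] := EM (P z); first by left.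
  by right; have [Mz|nMz] := EM (M z); [left|right].
pose J := M `\` P'.
have Jj : J j by split=> // /P'P.
have Jfew : few_edges J (N `\` J).
  have JM : J `<=` M by move=> z [].
  apply: few_edgesS (few_edgesUr (few_edges_sym (few_edgesS (fun z => id) _ P'few))
    (few_edgesS JM (fun z => id) Mfew)) => //; last first.
    by move=> z [/MN Nz nP'z].
  move=> z [Nz nJz]; have [Mz|nMz] := EM (M z); last by right.
  by left; apply: contrapT => nP'z; apply: nJz.
have [[J1 [J1J J10 J1few J1X]]|no] := EM (exists J1, [/\ J1 `<=` J, J1 !=set0,
    few_edges J1 (N `\` J1) & few_edges J1 X]).
  left; apply: (@grows_of_part _ L X Y M P' J1) => // A AJ1 A0 Afew AY.
  apply: (state_robust st (A := A)) => //.
  - by move=> z /AJ1/J1J[/MN[]].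
  - by move=> z /AJ1/J1J[/MN[_ nXY] _] Xz; apply: nXY; left.
  - by right=> z /AJ1/J1J[/MN[_ nXY] _] Yz; apply: nXY; right.
  - apply: few_edgesS (few_edgesUr Afew (few_edgesUr
      (few_edgesS AJ1 (fun z => id) J1X) AY)) => //.
    move=> z [Lz nAz]; have [Xz|nXz] := EM (X z); first by right; left.
    have [Yz|nYz] := EM (Y z); first by right; right.
    by left; split=> //; split=> //; case.
right; have NE : N = L `\` (Y `|` X) by rewrite setUC.
apply: (@grows_of_part _ L Y X M P' J) => //; rewrite -?NE //.
- exact: state_sym.
- exact: touch_sym.
- exact: full_sym.
- exact: thick_sym.
- by exists j.
- by move=> A AJ A0 Afew AX; apply: no; exists A.
Qed.

(** A subset closed under adjacency contains or avoids each end, so it or its complement would be a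
    cut without edges. *)
Lemma state_connected L X Y : state L X Y -> connected_set L.
Proof.
move=> [_ _ Xc Yc XL YL XY r]; split=> [|A [u Lu Au] Acl].
  by have [[x Xx] _] := Xc; exists x; exact: XL.
pose E := L `&` A.
have few : few_edges E (L `\` E).
  apply: few_edges0 => -[v [w [[Lv Av] [Lw nEw] vw]]]; apply: nEw.
  by split=> //; exact: Acl vw Av.
have sub C : connected_set C -> C `<=` L -> C `<=` E \/ disjoint E C.
  move=> Cc CL; have [[c [Cc' Ec]]|no] := EM (C `&` E !=set0); last first.
    by right=> z Ez Cz; apply: no; exists z.
  left; apply: Cc.2; first by exists c.
  by move=> v w Cv Cw vw [Lv Av]; split; [exact: CL|apply: Acl vw Av; exact: CL].
have [XE|EX] := sub X Xc XL; last first.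
  by case: (r E) => //; [move=> z []|exists u|exact: sub].
move=> w Lw; apply: contrapT => nAw.
case: (r (L `\` E)).
- by move=> z [].
- by exists w; split=> // -[].
- by move=> z [_ nE] /XE.
- have [YE|EY] := sub Y Yc YL; first by right=> z [_ nE] /YE.
  by left=> z Yz; split; [exact: YL|move=> Ez; exact: EY Ez Yz].
- apply: few_edgesS (few_edges_sym few) => // z [Lz nLE].
  by apply: contrapT => nEz; apply: nLE.
Qed.

(** [X] is first enlarged until it touches [Y]. An uncuttable full part [M] of the interior gives a
    clique; otherwise one side of a finite cut of [M] is thick and gives growth. *)
Lemma unsplit_cases L X Y : state L X Y -> ~ splits L X Y ->
  [\/ has_infinite_clique_minor, grows L X Y | grows L Y X].
Proof.
move=> st0 ns0.
have [X' [Xf' Xc' XX' X'L X'Y]] : exists X', [/\ finite_set X',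
    connected_set X', X `<=` X', X' `<=` L `\` Y & touch X' Y].
  case: (st0) => Xf Yf Xc Yc XL YL XY r.
  apply: connected_approach => //; first exact: state_connected st0.
  by have [[y Yy] _] := Yc; exists y; split=> //; exact: YL.
have st : state L X' Y.
  by apply: state_grow st0 _ _ _ _ _ => // z /X'L[].
have lk : linkage L X Y L X' Y X' Y.
  case: st => Xf Yf Xc Yc XL YL XY r; split=> // z [] //.
have ns : ~ splits L X' Y by move=> /(splits_linkage st lk).
have thN := thick_of_unsplit st X'Y ns.
pose N := L `\` (X' `|` Y); pose M := full_part X' Y N.
have MN : M `<=` N by exact: full_part_sub.
suff : [\/ has_infinite_clique_minor, grows L X' Y | grows L Y X'].
  case=> [?|g|g]; [by constructor 1| |].
    by constructor 2; exact: grows_linkage st lk g.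
  by constructor 3; exact: grows_linkage (state_sym st) (linkage_sym lk) g.
have Mt := full_part_thick thN; have Mf := @full_part_full _ X' Y N.
have Mfew := @full_part_few _ X' Y N; rewrite -/N -/M in Mt Mf Mfew.
have [[A [AM [a Aa] A0 Afew]]|no] := EM (exists A, [/\ A `<=` M, A !=set0,
    M `\` A !=set0 & few_edges A (M `\` A)]); last first.
  constructor 1; apply: clique_of_uncut st X'Y ns MN Mt _ => A AM A0 A1 Af.
  by apply: no; exists A.
have AE : M `\` (M `\` A) = A.
  apply/seteqP; split=> [z [Mz nMA]|z Az]; first by apply: contrapT => nA; apply: nMA.
  by split; [exact: AM|case].
have AU : A `|` (M `\` A) = M.
  apply/seteqP; split=> [z [/AM|[]] //|z Mz].
  by have [Az|nAz] := EM (A z); [left|right].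
have [At|Bt] := thick_setU Afew (eq_ind_r (thick X' Y) Mt AU).
  by have [g|g] := grows_of_cut st X'Y MN Mf Mfew AM A0 Afew At;
    [constructor 2|constructor 3].
have B0 : M `\` (M `\` A) !=set0 by rewrite AE; exists a.
have Bfew : few_edges (M `\` A) (M `\` (M `\` A)).
  by rewrite AE; exact: few_edges_sym.
have BM : M `\` A `<=` M by move=> z [].
by have [g|g] := grows_of_cut st X'Y MN Mf Mfew BM B0 Bfew Bt;
  [constructor 2|constructor 3].
Qed.

(** The last case fixes the orientation. Barring cliques, if some state linked to an unsplittable
    one does not grow, then with its ends swapped everything linked to it does, as growth the other
    way would carry back to it. *)
Lemma split_clique_or_grow :
  [\/ forall L X Y, state L X Y -> splits L X Y,
      has_infinite_clique_minor
    | exists L X Y, state L X Y /\ forall L' X' Y' U W,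
        state L' X' Y' -> linkage L X Y L' X' Y' U W -> grows L' X' Y'].
Proof.
have [?|nspl] := EM (forall L X Y, state L X Y -> splits L X Y); first by constructor 1.
have [?|ncl] := EM has_infinite_clique_minor; first by constructor 2.
constructor 3.
have [L [X [Y [st ns]]]] : exists L X Y, state L X Y /\ ~ splits L X Y.
  apply: contrapT => no; apply: nspl => L X Y st; apply: contrapT => ns.
  by apply: no; exists L, X, Y.
have [[L' [X' [Y' [U [W [st' lk ng]]]]]]|no] := EM (exists L' X' Y' U W,
    [/\ state L' X' Y', linkage L X Y L' X' Y' U W & ~ grows L' X' Y']); last first.
  exists L, X, Y; split=> // L' X' Y' U W st' lk; apply: contrapT => ng.
  by apply: no; exists L', X', Y', U, W.
exists L', Y', X'; split=> [|L1 X1 Y1 U1 W1 st1 /linkage_sym lk1].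
  exact: state_sym.
case: (unsplit_cases (L := L1) (X := X1) (Y := Y1)) => // [|g].
  move/splits_sym => s; apply: ns; apply: splits_linkage s; first exact: state_sym st1.
  exact: linkage_trans lk lk1.
by case: ng; apply: grows_linkage lk1 g; exact: state_sym.
Qed.

Lemma infinitely_edge_connected_state : infinitely_edge_connected G ->
  exists L X Y, state L X Y.
Proof.
move=> [[x [y xy]] ec]; exists setT, [set x], [set y].
split=> //; try exact: connected_set1.
- by move=> _ -> /xy.
apply: robust1_robust => A _ [a Aa] Ax f.
have ax : a <> x by move=> ax; apply: (Ax a Aa); rewrite ax.
pose F := (fun e : G * G => [set e.1; e.2]) @`
  [set e : G * G | [/\ A e.1, (setT `\` A) e.2 & adj e.1 e.2]].
have Ff : finite_set F by exact: finite_image.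
have FE : F `<=` edges G by move=> _ [[u v] /= [_ _ uv] <-]; exists u, v.
suff keep (u v : delete_edges F) : linked u v -> A u -> A v.
  by apply: (Ax x) => //; apply: keep (ec a x ax F Ff FE) Aa.
elim=> {u v} [u v /= [uv nF] Au|//|u v w _ IH1 _ IH2 /IH1/IH2//].
by apply: contrapT => nAv; apply: nF; exists (u, v).
Qed.

End Dichotomy.

(** * The Stern-Brocot tree *)

(** Words are nodes of a binary tree rooted at their right end: two are comparable or part below a
    last common node [u]. *)
Lemma seq_fork (w1 w2 : seq bool) :
  (exists s, w1 = s ++ w2) \/ (exists s, w2 = s ++ w1) \/
  exists u s1 s2 b, w1 = s1 ++ b :: u /\ w2 = s2 ++ ~~ b :: u.
Proof.
elim/last_ind: w1 w2 => [|w1 a IH] w2; first by right; left; exists w2; rewrite cats0.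
case/lastP: w2 => [|w2 b]; first by left; exists (rcons w1 a); rewrite cats0.
have [->|ab] := eqVneq a b.
  have [[s ->]|[[s ->]|[u [s1 [s2 [c [-> ->]]]]]]] := IH w2.
  - by left; exists s; rewrite rcons_cat.
  - by right; left; exists s; rewrite rcons_cat.
  - by right; right; exists (rcons u b), s1, s2, c; rewrite !rcons_cat.
right; right; exists [::], w1, w2, a; rewrite !cats1.
by have -> : ~~ a = b by case: a b ab => [] [].
Qed.

Section SternBrocot.
Local Open Scope ring_scope.

(** For positive second coordinates, a negative value means that the fraction of [u] is the smaller
    one. *)
Definition det2 (u v : int * int) : int := u.1 * v.2 - u.2 * v.1.

Definition vadd (u v : int * int) : int * int := (u.1 + v.1, u.2 + v.2).

(* A word, read from right to left, is a path down the Stern-Brocot tree; the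
   root interval runs from -1/0 to 1/0 and is cut at 0/1. *)
Fixpoint ends (w : seq bool) : (int * int) * (int * int) :=
  if w is b :: w' then
    let m := if w' is [::] then (0, 1) else vadd (ends w').1 (ends w').2 in
    if b then (m, (ends w').2) else ((ends w').1, m)
  else ((-1, 0), (1, 0)).

(** The root is treated separately because its two ends add up to the zero vector. *)
Definition mid (w : seq bool) : int * int :=
  if w is [::] then (0, 1) else vadd (ends w).1 (ends w).2.

Lemma ends_cons b w :
  ends (b :: w) = if b then (mid w, (ends w).2) else ((ends w).1, mid w).
Proof. by case: w. Qed.

Lemma midE (w : seq bool) : w != [::] -> mid w = vadd (ends w).1 (ends w).2.
Proof. by case: w. Qed.

Lemma det2Dr u v v' : det2 u (vadd v v') = det2 u v + det2 u v'.
Proof. rewrite /det2 /vadd /=; ring. Qed.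

Lemma det2Dl u u' v : det2 (vadd u u') v = det2 u v + det2 u' v.
Proof. rewrite /det2 /vadd /=; ring. Qed.

Lemma det2xx u : det2 u u = 0.
Proof. rewrite /det2; ring. Qed.

Lemma det2C u v : det2 u v = - det2 v u.
Proof. rewrite /det2; ring. Qed.

Lemma ends_det (w : seq bool) : w != [::] ->
  [/\ det2 (ends w).1 (ends w).2 = -1, 0 <= (ends w).1.2 & 0 <= (ends w).2.2].
Proof.
elim: w => // b w IH _; rewrite ends_cons.
have [->|w0] := eqVneq w [::]; first by case: b.
have [d x0 y0] := IH w0; rewrite (midE w0).
case: b => /=; rewrite ?det2Dr ?det2Dl ?det2xx ?d; split=> //; lia.
Qed.

Lemma mid_gt0 w : 0 < (mid w).2.
Proof.
have [->//|w0] := eqVneq w [::].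
have [d x0 y0] := ends_det w0; rewrite (midE w0) /vadd /=.
move: d x0 y0; rewrite /det2; case: (ends w) => [[a b] [c e]] /=.
have [->|] := eqVneq b 0; have [->|] := eqVneq e 0; lia.
Qed.

(** Intervals below [w] stay inside that of [w]; determinants say so even if an end is infinite. *)
Lemma ends_nested (s w : seq bool) : w != [::] ->
  [/\ det2 (ends w).1 (ends (s ++ w)).2 < 0, det2 (ends w).1 (ends (s ++ w)).1 <= 0,
      det2 (ends (s ++ w)).1 (ends w).2 < 0 & det2 (ends (s ++ w)).2 (ends w).2 <= 0].
Proof.
move=> w0; elim: s => [|b s [i1 i2 i3 i4]] /=.
  by have [-> _ _] := ends_det w0; rewrite !det2xx.
have sw0 : s ++ w != [::] by case: (s).
rewrite -/(ends (b :: (s ++ w))) ends_cons (midE sw0).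
case: b => /=; rewrite ?det2Dr ?det2Dl; split; lia.
Qed.

Lemma mid_nested (s w : seq bool) : w != [::] ->
  det2 (ends w).1 (mid (s ++ w)) < 0 /\ det2 (mid (s ++ w)) (ends w).2 < 0.
Proof.
move=> w0; have sw0 : s ++ w != [::] by case: (s).
have [] := ends_nested s w0; rewrite (midE sw0) det2Dr det2Dl; lia.
Qed.

Lemma mid_left (s w : seq bool) : det2 (mid (s ++ false :: w)) (mid w) < 0.
Proof. by have [_] := mid_nested s (w := false :: w) isT; rewrite ends_cons. Qed.

Lemma mid_right (s w : seq bool) : det2 (mid w) (mid (s ++ true :: w)) < 0.
Proof. by have [] := mid_nested s (w := true :: w) isT; rewrite ends_cons. Qed.

Lemma mid_desc (s w : seq bool) : s != [::] -> det2 (mid (s ++ w)) (mid w) != 0.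
Proof.
case/lastP: s => // s b _; rewrite cat_rcons.
by case: b; [have := mid_right s w; rewrite det2C|have := mid_left s w]; lia.
Qed.

Lemma det2_trans u v w : 0 < u.2 -> 0 < v.2 -> 0 < w.2 ->
  det2 u v < 0 -> det2 v w < 0 -> det2 u w < 0.
Proof.
case: u v w => [a b] [c d] [e f]; rewrite /det2 /= => b0 d0 f0 h1 h2.
have e1 : d * (a * f - b * e) = f * (a * d - b * c) + b * (c * f - d * e) by ring.
have h3 : f * (a * d - b * c) < 0 by rewrite pmulr_rlt0.
have h4 : b * (c * f - d * e) < 0 by rewrite pmulr_rlt0.
by rewrite -(pmulr_rlt0 _ d0) e1; lia.
Qed.

Lemma mid_fork u s1 s2 :
  det2 (mid (s1 ++ false :: u)) (mid (s2 ++ true :: u)) < 0.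
Proof.
by apply: det2_trans (mid_left s1 u) (mid_right s2 u); exact: mid_gt0.
Qed.

Lemma mid_inj w1 w2 : det2 (mid w1) (mid w2) = 0 -> w1 = w2.
Proof.
move=> e; have [[s E]|[[s E]|[u [s1 [s2 [b [E1 E2]]]]]]] := seq_fork w1 w2.
- have [s0|/(mid_desc w2)] := eqVneq s [::]; first by rewrite E s0.
  by rewrite -E e.
- have [s0|/(mid_desc w1)] := eqVneq s [::]; first by rewrite E s0.
  by rewrite -E det2C e.
- move: e; rewrite E1 E2; case: b {E1 E2} => /=; last first.
    by move=> e; have := mid_fork u s1 s2; rewrite e.
  by move=> e; have := mid_fork u s2 s1; rewrite det2C e.
Qed.

Definition vcomb (m n : nat) (u v : int * int) : int * int :=
  (m%:Z * u.1 + n%:Z * v.1, m%:Z * u.2 + n%:Z * v.2).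

Lemma vcomb_left m n u v : (n <= m)%N ->
  vcomb (m - n) n u (vadd u v) = vcomb m n u v.
Proof. by move=> nm; rewrite /vcomb /vadd -subzn //=; congr pair; ring. Qed.

Lemma vcomb_right m n u v : (m <= n)%N ->
  vcomb m (n - m) (vadd u v) v = vcomb m n u v.
Proof. by move=> nm; rewrite /vcomb /vadd -subzn //=; congr pair; ring. Qed.

(** A subtractive Euclidean algorithm on both coefficient pairs at once: while both vectors lie in
    one half of the interval, pass to that half and shrink their coefficients. *)
Lemma stern_brocot_edge (k m n m' n' : nat) (w : seq bool) :
  w != [::] -> (m + n + m' + n' <= k)%N ->
  m%:Z * n'%:Z - n%:Z * m'%:Z = 1 \/ m%:Z * n'%:Z - n%:Z * m'%:Z = -1 ->
  let p := vcomb m n (ends w).1 (ends w).2 in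
  let q := vcomb m' n' (ends w).1 (ends w).2 in
  exists s, ends (s ++ w) = (p, q) \/ ends (s ++ w) = (q, p).
Proof.
elim: k m n m' n' w => [|k IH] m n m' n' w w0 le_k det /=.
  have [? [? [? ?]]] : m = 0%N /\ n = 0%N /\ m' = 0%N /\ n' = 0%N by lia.
  by subst; lia.
have vc1 : vcomb 1 0 (ends w).1 (ends w).2 = (ends w).1.
  by rewrite /vcomb !mul1r !mul0r !addr0 -surjective_pairing.
have vc2 : vcomb 0 1 (ends w).1 (ends w).2 = (ends w).2.
  by rewrite /vcomb !mul1r !mul0r !add0r -surjective_pairing.
have [/andP[nm nm']|out1] := boolP ((n <= m) && (n' <= m'))%N.
  have [||s hs] := IH (m - n)%N n (m' - n')%N n' (false :: w) isT.
  + suff : (n + n' != 0)%N by lia.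
    rewrite addn_eq0; apply/negP => /andP[/eqP ? /eqP ?].
    by subst; rewrite !(mul0r, mulr0) in det; lia.
  + by move: det; rewrite -!subzn //; lia.
  exists (s ++ [:: false]); rewrite -catA /=.
  by move: hs; rewrite ends_cons (midE w0) /= !vcomb_left.
have [/andP[mn mn']|out2] := boolP ((m <= n) && (m' <= n'))%N.
  have [||s hs] := IH m (n - m)%N m' (n' - m')%N (true :: w) isT.
  + suff : (m + m' != 0)%N by lia.
    rewrite addn_eq0; apply/negP => /andP[/eqP ? /eqP ?].
    by subst; rewrite !(mul0r, mulr0) in det; lia.
  + by move: det; rewrite -!subzn //; lia.
  exists (s ++ [:: true]); rewrite -catA /=.
  by move: hs; rewrite ends_cons (midE w0) /= !vcomb_right.
(* Vectors in different halves with determinant 1 or -1 must be the two ends themselves. *)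
have [[nm mn']|[mn nm']] : ((n < m) /\ (m' < n') \/ (m < n) /\ (n' < m'))%N by lia.
- have [? [? [? ?]]] : m = 1%N /\ n = 0%N /\ m' = 0%N /\ n' = 1%N by nia.
  by subst; exists [::]; left; rewrite vc1 vc2 -surjective_pairing.
- have [? [? [? ?]]] : m = 0%N /\ n = 1%N /\ m' = 1%N /\ n' = 0%N by nia.
  by subst; exists [::]; right; rewrite vc1 vc2 -surjective_pairing.
Qed.

Definition frac (v : int * int) : option rat :=
  if v.2 == 0 then None else Some (v.1%:~R / v.2%:~R).

Lemma frac_num_den (x : rat) : frac (numq x, denq x) = Some x.
Proof. by rewrite /frac /= (negPf (denq_neq0 x)) divq_num_den. Qed.

Lemma frac_eq u v : u.2 != 0 -> v.2 != 0 -> frac u = frac v -> det2 u v = 0.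
Proof.
rewrite /frac /det2 => u0 v0; rewrite (negPf u0) (negPf v0) => -[] /eqP.
rewrite eqr_div ?intr_eq0 // -!intrM eqr_int => /eqP; lia.
Qed.

(** No edge joins a negative to a positive rational, so both endpoints lie in the interval
    [[:: true]] or both in [[:: false]]; infinity belongs to either. *)
Lemma farey_edge (p q : option rat) : farey_adj p q ->
  exists w : seq bool, w != [::] /\
  (frac (ends w).1 = p /\ frac (ends w).2 = q \/
   frac (ends w).1 = q /\ frac (ends w).2 = p).
Proof.
move=> pq.
pose sg (x : option rat) : int := if x is Some x then numq x else 0.
have key (w : seq bool) m n m' n' : w != [::] ->
    frac (vcomb m n (ends w).1 (ends w).2) = p ->
    frac (vcomb m' n' (ends w).1 (ends w).2) = q ->
    m%:Z * n'%:Z - n%:Z * m'%:Z = 1 \/ m%:Z * n'%:Z - n%:Z * m'%:Z = -1 ->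
    exists w : seq bool, w != [::] /\
      (frac (ends w).1 = p /\ frac (ends w).2 = q \/
       frac (ends w).1 = q /\ frac (ends w).2 = p).
  move=> w0 fp fq /(stern_brocot_edge w0 (leqnn _)) /= [s hs].
  exists (s ++ w); split; first by case: (s).
  by case: hs => ->; [left|right].
have [[p0 q0]|[p0 q0]] : (0 <= sg p /\ 0 <= sg q) \/ (sg p <= 0 /\ sg q <= 0).
  clear key; move: pq; rewrite /sg /farey_adj; case: p q => [p|] [q|] /=; try lia.
  have := denq_gt0 p; have := denq_gt0 q.
  move: (numq p) (denq p) (numq q) (denq q) => a b c d; nia.
(* Coordinates over the ends 0/1 and 1/0; the other half uses -1/0 and 0/1. *)
- pose m (x : option rat) := if x is Some x then `|denq x|%N else 0%N.
  pose n (x : option rat) := if x is Some x then `|numq x|%N else 1%N.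
  have fr x : 0 <= sg x ->
      frac (vcomb (m x) (n x) (ends [:: true]).1 (ends [:: true]).2) = x.
    case: x => [x|] //= x0; rewrite -[RHS]frac_num_den /vcomb /=; congr frac.
    by have dx := denq_gt0 x; congr pair; lia.
  apply: (key [:: true] (m p) (n p) (m q) (n q)) => //; try exact: fr.
  clear key fr; move: pq p0 q0; rewrite /farey_adj /sg /m /n.
  case: p q => [p|] [q|] /=.
  + have := denq_gt0 p; have := denq_gt0 q; nia.
  + have := denq_gt0 p; nia.
  + have := denq_gt0 q; nia.
  + lia.
- pose m (x : option rat) := if x is Some x then `|numq x|%N else 1%N.
  pose n (x : option rat) := if x is Some x then `|denq x|%N else 0%N.
  have fr x : sg x <= 0 ->
      frac (vcomb (m x) (n x) (ends [:: false]).1 (ends [:: false]).2) = x.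
    case: x => [x|] //= x0; rewrite -[RHS]frac_num_den /vcomb /=; congr frac.
    by have dx := denq_gt0 x; congr pair; lia.
  apply: (key [:: false] (m p) (n p) (m q) (n q)) => //; try exact: fr.
  clear key fr; move: pq p0 q0; rewrite /farey_adj /sg /m /n.
  case: p q => [p|] [q|] /=.
  + have := denq_gt0 p; have := denq_gt0 q; nia.
  + have := denq_gt0 p; nia.
  + have := denq_gt0 q; nia.
  + lia.
Qed.

End SternBrocot.

(** * Infinite edge-connectivity of the two graphs *)

Lemma linked_sym (G : graph) (x y : G) : linked x y -> linked y x.
Proof.
elim=> [u v /adj_sym uv|u|u v w _ IH1 _ IH2]; [exact: rt_step|exact: rt_refl|].
exact: rt_trans IH2 IH1.
Qed.

Lemma finite_set_bound (T : Type) (f : T -> nat) (D : set T) : finite_set D ->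
  exists N, forall x, D x -> (f x <= N)%N.
Proof.
move=> /(finite_image f)/finite_seqP[s sE]; exists (\max_(i <- s) i) => x Dx.
apply: leq_bigmax_seq => //; have : (f @` D) (f x) by exists x.
by rewrite sE.
Qed.

Lemma finite_edges_cover (G : graph) (F : set (set G)) : finite_set F ->
  F `<=` edges G -> finite_set (\bigcup_(e in F) e).
Proof.
move=> Ff FE; apply: bigcup_finite => // e /FE[x [y [_ ->]]].
exact: finite_set2.
Qed.

Section Farey.
Local Open Scope ring_scope.

Lemma num_den_frac (a b : int) : 0 < b -> coprimez a b ->
  numq (a%:~R / b%:~R) = a /\ denq (a%:~R / b%:~R) = b.
Proof.
rewrite coprimezE => b0 ab.
by rewrite (coprimeq_num ab) (coprimeq_den ab) gtr0_sg // gt_eqF // gtr0_norm ?mul1r.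
Qed.

Lemma coprimez_det (a b c d : int) : a * d - b * c = 1 \/ a * d - b * c = -1 ->
  coprimez a b.
Proof.
by case=> h; apply/coprimezP; [exists (d, - c)|exists (- d, c)] => /=; lia.
Qed.

Lemma farey_parent (x : rat) : 1 < denq x ->
  exists y : rat, denq y < denq x /\ farey_adj (Some x) (Some y).
Proof.
have := coprime_num_den x; rewrite -coprimezE => /coprimezP[[u v] /=].
rewrite /farey_adj /=; move: (numq x) (denq x) => a b uv b1.
have b0 : b != 0 by lia.
(* A Bezout coefficient reduced modulo [b]; [c] is what then makes the determinant 1. *)
pose d : int := (u %% b)%Z; pose c : int := - (v + a * (u %/ b)%Z).
have e : a * d - b * c = 1.
  by move: uv; rewrite {1}(divz_eq u b) -/d /c => <-; ring.
have d0 : 0 <= d := modz_ge0 u b0.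
have db : d < b by have := ltz_mod u b0; rewrite gtr0_norm //; lia.
clearbody c d; have {}d0 : 0 < d.
  rewrite lt_def d0 andbT; apply/eqP => d00; move: e; rewrite d00 mulr0 => e.
  by have [c0|c0] := lerP 0 c; nia.
have cd : coprimez c d by apply: (@coprimez_det c d a b); right; rewrite -e; ring.
by have [hn hd] := num_den_frac d0 cd; exists (c%:~R / d%:~R); rewrite hn hd; lia.
Qed.

Lemma farey_integer (x : rat) : denq x = 1 -> farey_adj (Some x) None.
Proof. by move=> x1; right; rewrite /= x1; lia. Qed.

Lemma farey_neighbour (q : option rat) : exists q', farey_adj q q'.
Proof.
case: q => [x|]; last by exists (Some 0); left.
have [x1|x1] := ltrP 1 (denq x).
  by have [y [_ xy]] := farey_parent x1; exists (Some y).
exists None; apply: farey_integer; have := denq_gt0 x; lia.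
Qed.

Lemma farey_mediant (x y : rat) : farey_adj (Some x) (Some y) -> exists z : rat,
  [/\ denq z = denq x + denq y, farey_adj (Some x) (Some z)
    & farey_adj (Some z) (Some y)].
Proof.
rewrite /farey_adj /= => xy.
have d0 : 0 < denq x + denq y by have := denq_gt0 x; have := denq_gt0 y; lia.
have cd : coprimez (numq x + numq y) (denq x + denq y).
  apply: (@coprimez_det _ _ (numq y) (denq y)).
  by case: xy => xy; [left|right]; rewrite -xy; ring.
have [hn hd] := num_den_frac d0 cd.
exists ((numq x + numq y)%:~R / (denq x + denq y)%:~R); rewrite hn hd.
by split=> //; case: xy => xy; [left|right|left|right]; rewrite -xy; ring.
Qed.

(** Edges with an end of size above [N] survive. Edges between rationals are bypassed through
    mediants of growing denominator; parents lead down to an integer, and steps by 1 to one so large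
    that its edge to infinity survives. *)
Lemma farey_infinitely_edge_connected : infinitely_edge_connected farey_graph.
Proof.
split; first by exists None, (Some 0).
move=> x0 y0 _ F Ff FE.
have Df := finite_edges_cover Ff FE.
have [N hN] := finite_set_bound
  (fun x : farey_graph => `|farey_num x|%N + `|farey_den x|%N)%N Df.
have inF (x y : farey_graph) : F [set x; y] ->
    (`|farey_num x| + `|farey_den x| <= N)%N /\ (`|farey_num y| + `|farey_den y| <= N)%N.
  by move=> Fxy; split; apply: hN; exists [set x; y] => //=; [left|right].
have fin k (x y : rat) : farey_adj (Some x) (Some y) ->
    (N + N < `|denq x| + `|denq y| + k)%N ->
    @linked (delete_edges F) (Some x) (Some y).
  elim: k x y => [|k IH] x y xy hk.
    by apply: rt_step; split=> // /inF /=; lia.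
  have [z [dz xz zy]] := farey_mediant xy.
  have := denq_gt0 x; have := denq_gt0 y => dy dx.
  by apply: rt_trans (IH x z xz _) (IH z y zy _); lia.
have {}fin (x y : rat) : farey_adj (Some x) (Some y) ->
    @linked (delete_edges F) (Some x) (Some y).
  move=> xy; apply: (fin (N + N).+1 x y xy); lia.
have int_num (n : int) : numq (n%:~R : rat) = n /\ denq (n%:~R : rat) = 1.
  by rewrite numq_int denq_int.
have up (n : int) k : @linked (delete_edges F) (Some n%:~R) (Some (n + k%:Z)%:~R).
  elim: k => [|k IH]; first by rewrite addr0; exact: rt_refl.
  apply: rt_trans IH _; apply: fin; right; rewrite /= !numq_int !denq_int; lia.
have inf (n : int) : @linked (delete_edges F) (Some n%:~R) None.
  apply: rt_trans (up n (N + `|n|).+1) _; apply: rt_step; split.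
    by apply: farey_integer; rewrite denq_int.
  by move=> /inF[] /=; rewrite numq_int; lia.
have base k (x : rat) : (`|denq x| <= k)%N ->
    @linked (delete_edges F) (Some x) None.
  elim: k x => [|k IH] x xk; first by have := denq_gt0 x; lia.
  have [x1|x1] := ltrP 1 (denq x).
    have [y [yx xy]] := farey_parent x1; apply: rt_trans (fin _ _ xy) (IH y _).
    have := denq_gt0 y; lia.
  have dx : denq x = 1 by have := denq_gt0 x; lia.
  by rewrite -[x]divq_num_den dx divr1.
have {}base (x : farey_graph) : @linked (delete_edges F) x None.
  by case: x => [x|]; [exact: base (leqnn _)|exact: rt_refl].
by apply: rt_trans (base x0) _; exact/linked_sym/base.
Qed.

End Farey.

(** [N] bounds the first letters of the ends of deleted edges, so the path from [s] to the apex
    through the child [N.+1 :: s] survives. *)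
Lemma cone_tree_infinitely_edge_connected :
  infinitely_edge_connected (cone T_aleph0).
Proof.
split; first by exists None, (Some [::]).
move=> x0 y0 _ F Ff FE.
have Df := finite_edges_cover Ff FE.
pose hd (x : cone T_aleph0) := if x is Some (n :: _) then n else 0%N.
have [N hN] := finite_set_bound hd Df.
have base (x : cone T_aleph0) : @linked (delete_edges F) x None.
  case: x => [s|]; last exact: rt_refl.
  have notF (y : cone T_aleph0) : ~ F [set Some (N.+1 :: s); y].
    move=> Fe; suff : (hd (Some (N.+1 :: s)) <= N)%N by rewrite /= ltnn.
    by apply: hN; exists [set Some (N.+1 :: s); y] => //=; left.
  apply: (@rt_trans _ _ _ (Some (N.+1 :: s))); apply: rt_step; split=> //.
  - by left; exists N.+1.
  - by rewrite setUC; exact: notF.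
by apply: rt_trans (base x0) _; exact/linked_sym/base.
Qed.

(** * The Farey graph as a minor *)

Section BinarySystem.
Context {G : graph} {Lab : Type}.
Variables (L : seq bool -> set G) (S B : seq bool -> bool -> set G).
Variable lab : seq bool -> bool -> Lab.

(* A binary tree of states: the one at [w] lives in [L w], its two ends [B w]
   are enlarged to [S w], and [lab] tells which ends belong to the same branch
   set of the minor under construction. *)
Record binary_system : Prop := BinarySystem {
  bs_end : forall w b, B w b `<=` S w b;
  bs_sub : forall w b, S w b `<=` L w;
  bs_anti : forall w c, L (c :: w) `<=` L w;
  bs_disj : forall w, disjoint (S w false) (S w true);
  bs_child : forall w b c z, S w b z -> L (c :: w) z ->
    exists b', B (c :: w) b' z /\ lab (c :: w) b' = lab w b;
  bs_fork : forall w z, L (false :: w) z -> L (true :: w) z ->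
    exists b0 b1, [/\ B (false :: w) b0 z, B (true :: w) b1 z
      & lab (false :: w) b0 = lab (true :: w) b1] }.

Hypothesis sys : binary_system.

Lemma bs_anti_cat s w : L (s ++ w) `<=` L w.
Proof. by elim: s => //= c s IH z /(bs_anti sys)/IH. Qed.

Lemma bs_side w b c z : S w b z -> S w c z -> b = c.
Proof.
case: b c => [] [] // h1 h2.
- by case: (bs_disj sys h2 h1).
- by case: (bs_disj sys h1 h2).
Qed.

Lemma bs_label_end s w b c z : S (s ++ w) b z -> B w c z ->
  lab (s ++ w) b = lab w c.
Proof.
elim/last_ind: s w c => [|s a IH] w c /=.
  by move=> Sz /(bs_end sys) Sz'; rewrite (bs_side Sz Sz').
rewrite cat_rcons => Sz /(bs_end sys) Swz.
have Lz : L (a :: w) z by apply: bs_anti_cat; exact: bs_sub sys _ _ _ Sz.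
have [b' [Bz <-]] := bs_child sys Swz Lz.
exact: IH Sz Bz.
Qed.

Lemma bs_label_cat s w b c z : S (s ++ w) b z -> S w c z ->
  lab (s ++ w) b = lab w c.
Proof.
case/lastP: s => [|s a] /=; first by move=> h1 h2; rewrite (bs_side h1 h2).
rewrite cat_rcons => Sz Swz.
have Lz : L (a :: w) z by apply: bs_anti_cat; exact: bs_sub sys _ _ _ Sz.
have [b' [Bz <-]] := bs_child sys Swz Lz.
exact: bs_label_end Sz Bz.
Qed.

(** Makes the branch sets disjoint. Between comparable words [z] passes from end to end with its
    label unchanged; where words part, [bs_fork] puts [z] into equally labelled ends of both
    children. *)
Lemma bs_label w1 w2 b c z : S w1 b z -> S w2 c z -> lab w1 b = lab w2 c.
Proof.
move=> S1 S2; have [[s E]|[[s E]|[u [s1 [s2 [a [E1 E2]]]]]]] := seq_fork w1 w2.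
- by move: S1; rewrite E => S1; exact: bs_label_cat S1 S2.
- by move: S2; rewrite E => S2; rewrite (bs_label_cat S2 S1).
have L1 : L (a :: u) z.
  by apply: (@bs_anti_cat s1); rewrite -E1; exact: bs_sub sys _ _ _ S1.
have L2 : L (~~ a :: u) z.
  by apply: (@bs_anti_cat s2); rewrite -E2; exact: bs_sub sys _ _ _ S2.
rewrite E1 in S1 *; rewrite E2 in S2 *.
case: a L1 L2 S1 S2 {E1 E2} => /= L1 L2 S1 S2.
- have [b0 [b1 [B0 B1 e]]] := bs_fork sys L2 L1.
  by rewrite (bs_label_end S1 B1) (bs_label_end S2 B0).
- have [b0 [b1 [B0 B1 e]]] := bs_fork sys L1 L2.
  by rewrite (bs_label_end S1 B0) (bs_label_end S2 B1).
Qed.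

End BinarySystem.

Section FareyMinor.
Context {G : graph}.

Definition state_triple := {p : set G * set G * set G | state p.1.1 p.1.2 p.2}.

Implicit Types p : state_triple.

Definition dom p : set G := (sval p).1.1.
Definition endl p : set G := (sval p).1.2.
Definition endr p : set G := (sval p).2.

Definition mk_state (L X Y : set G) (st : state L X Y) : state_triple :=
  exist (fun t : set G * set G * set G => state t.1.1 t.1.2 t.2) (L, X, Y) st.

Definition triple_state p : state (dom p) (endl p) (endr p) := svalP p.

(** The node whose midpoint first created the end [b] of the interval [w]. Both ends of the root get
    [None], as -1/0 and 1/0 stand for the same vertex. *)
Fixpoint birth (w : seq bool) (b : bool) : option (seq bool) :=
  if w is c :: w' then if b == c then birth w' b else Some w' else None.

Definition birth_frac (o : option (seq bool)) : option rat :=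
  if o is Some w then frac (mid w) else None.

Lemma birth_fracE w b :
  birth_frac (birth w b) = frac (if b then (ends w).2 else (ends w).1).
Proof.
elim: w b => [|c w IH] b; first by case: b.
by rewrite ends_cons /=; case: b c => [] [] //=; rewrite IH.
Qed.

Lemma birth_frac_inj : injective birth_frac.
Proof.
have m0 w : ((mid w).2 == 0)%R = false.
  by apply/negbTE; rewrite gt_eqF ?mid_gt0.
move=> [w1|] [w2|] //= e; last 2 first.
- by move: e; rewrite /frac m0.
- by move: e; rewrite /frac m0.
by congr Some; apply: mid_inj; apply: frac_eq e; rewrite m0.
Qed.

Hypothesis all_split : forall L X Y : set G, state L X Y -> splits L X Y.

Lemma split_choice : exists (U W : state_triple -> set G)
    (p1 p2 : state_triple -> state_triple), forall p,
  splitting (dom p) (endl p) (endr p) (U p) (W p) (endr (p1 p))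
    (dom (p1 p)) (dom (p2 p)) (endl (p1 p)) (endr (p2 p)) /\
  endl (p2 p) = endr (p1 p).
Proof.
have /choice[f fP] p : exists d : set G * set G * state_triple * state_triple,
    splitting (dom p) (endl p) (endr p) d.1.1.1 d.1.1.2 (endr d.1.2)
      (dom d.1.2) (dom d.2) (endl d.1.2) (endr d.2) /\
    endl d.2 = endr d.1.2.
  have [U [W [Z [L1 [L2 [X1 [Y2 sp]]]]]]] := all_split (triple_state p).
  by exists (U, W, mk_state (split_state1 sp), mk_state (split_state2 sp)).
by exists (fun p => (f p).1.1.1), (fun p => (f p).1.1.2), (fun p => (f p).1.2),
  (fun p => (f p).2).
Qed.

(** The branch set of [q] is the union of all ends labelled [q]; every Farey edge is an interval of
    the tree, whose two ends touch. *)
Lemma farey_minor_of_splits p : minor farey_graph G.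
Proof.
have [U [W [p1 [p2 sp]]]] := split_choice.
pose st := fix st (w : seq bool) : state_triple :=
  if w is c :: w' then if c then p2 (st w') else p1 (st w') else p.
pose S w (b : bool) := if b then W (st w) else U (st w).
pose B w (b : bool) := if b then endr (st w) else endl (st w).
have sys : binary_system (fun w => dom (st w)) S B birth.
  split.
  - by move=> w []; [exact: split_subr (sp (st w)).1|exact: split_subl (sp (st w)).1].
  - by move=> w []; [exact: split_Wl (sp (st w)).1|exact: split_Ul (sp (st w)).1].
  - by move=> w [] /=; [exact: split_sub2 (sp (st w)).1|exact: split_sub1 (sp (st w)).1].
  - by move=> w; exact: split_disj (sp (st w)).1.
  - move=> w b c z Sz Lz; exists c; rewrite /=.
    have [s _] := sp (st w); case: b c Sz Lz => [] [] /= Sz Lz; split=> //.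
    + exact: (split_meet2 s).
    + by case: (split_out1 s Sz Lz).
    + by case: (split_out1 s Sz Lz).
    + by case: (split_out2 s Sz Lz).
    + by case: (split_out2 s Sz Lz).
    + exact: (split_meet1 s).
  - move=> w z L0 L1; have [s e] := sp (st w).
    have Zz : endr (p1 (st w)) z by apply: (split_mid s).
    by exists true, false; split=> //=; rewrite /B /= ?e.
pose D (q : option rat) : set (seq bool * bool) :=
  [set i | birth_frac (birth i.1 i.2) = q].
have Sc i : connected_set (S i.1 i.2).
  case: i => w [] /=; [exact: split_conr (sp (st w)).1|].
  exact: split_conl (sp (st w)).1.
have edge (q q' : farey_graph) : adj q q' -> exists w b, D q (w, b) /\ D q' (w, ~~ b).
  move=> /farey_edge[w [_ [[<- <-]|[<- <-]]]].
    by exists w, false; split; rewrite /D /= birth_fracE.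
  by exists w, true; split; rewrite /D /= birth_fracE.
have touchS w b : touch (S w b) (S w (~~ b)).
  case: b => /=; last exact: split_touch (sp (st w)).1.
  by apply: touch_sym; exact: split_touch (sp (st w)).1.
(* A label born at [w] is represented by the right end of the left child, infinity by the right end
   of the root. *)
pose rep (o : option (seq bool)) := if o is Some w then (false :: w, true)
  else ([::], true).
have D0 q : D q !=set0.
  have [q' /edge[w [b [Dq _]]]] := farey_neighbour q; by exists (w, b).
exists (fun q => \bigcup_(i in D q) S i.1 i.2); split.
- move=> q; have [i Di] := D0 q; have [[z Sz] _] := Sc i.
  by exists z, i.
- apply/trivIsetP => q q' _ _ qq'; apply/seteqP; split=> // z.
  move=> [[[w b] /= Dq Sz] [[w' b'] /= Dq' Sz']].
  by move/eqP: qq'; apply; rewrite -Dq -Dq' (bs_label sys Sz Sz').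
- move=> q; apply: connected_set_induced; apply: connected_bigcup => //.
  move=> E [i Di Ei] Ecl j Dj.
  (* Each end meets the same end one level higher, up to its birth, where both children share it;
     the two root ends are joined by an edge. *)
  have Erep (k : seq bool * bool) : D q k -> (E k <-> E (rep (birth k.1 k.2))).
    have step k1 k2 : D q k1 -> D q k2 ->
        (S k1.1 k1.2 `&` S k2.1 k2.2 !=set0) \/ touch (S k1.1 k1.2) (S k2.1 k2.2) ->
        (E k1 <-> E k2).
      move=> D1 D2 t; split=> Ek; first exact: Ecl D1 D2 Ek t.
      by apply: Ecl D2 D1 Ek _; rewrite setIC; case: t => [|/touch_sym]; tauto.
    case: k => w; elim: w => [|c w IH] b Db.
      case: b Db => Db //=; apply: step => //; right.
      exact: touchS [::] false.
    rewrite /=; have [bc|bc] := eqVneq b c.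
      have Db' : D q (w, b) by rewrite -Db /D /= bc eqxx.
      rewrite -(IH b Db'); apply: step => //; left.
      have [s _] := sp (st w).
      have [[z Bz] _] : connected_set (B (c :: w) b).
        have h := triple_state (st (c :: w)).
        by case: (b); [exact: state_conr h|exact: state_conl h].
      exists z; split; first exact: (bs_end sys).
      move: Bz; rewrite bc /S /B; case: (c) => /= Bz.
        exact: (split_end2 s).
      exact: (split_end1 s).
    have [s e] := sp (st w).
    have [[z Zz] _] := state_conr (split_state1 s).
    apply: step; first by [].
      by rewrite -Db /D /= (negPf bc).
    left; exists z; split; last by apply: (bs_end sys); exact: Zz.
    apply: (bs_end sys); case: b c bc Db => [] [] //= _ _; rewrite /B /= ?e //.
  apply/(Erep j Dj); have -> : birth j.1 j.2 = birth i.1 i.2.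
    by apply: birth_frac_inj; rewrite Dj Di.
  exact/(Erep i Di).
- move=> q q' /edge[w [b [Dq Dq']]]; have [x [y [Sx Sy xy]]] := touchS w b.
  by exists x, y; split=> //; [exists (w, b)|exists (w, ~~ b)].
Qed.

End FareyMinor.

(** * The cone over the tree as a minor *)

(** A countable graph is a minor of an infinite clique; [pickle] numbers its vertices. *)
Lemma cone_tree_minor_of_clique (G : graph) :
  @has_infinite_clique_minor G -> minor (cone T_aleph0) G.
Proof.
move=> [V [Vc Vd Vt]]; exists (fun h : option (seq nat) => V (pickle h)).
have neq (h h' : option (seq nat)) : h <> h' ->
    (pickle h < pickle h')%N \/ (pickle h' < pickle h)%N.
  move=> hh'; apply/orP; rewrite -neq_ltn; apply/eqP => e; apply: hh'.
  exact: (pcan_inj (@pickleK _)).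
split.
- by move=> h; have [] := Vc (pickle h).
- apply/trivIsetP => h h' _ _ /eqP/neq lt; apply/seteqP; split=> // z [Vz Vz'].
  by case: lt => lt; [apply: (Vd _ _ lt z)|apply: (Vd _ _ lt z)].
- by move=> h; apply: connected_set_induced.
- move=> h h' hh'; have /neq[lt|lt] : h <> h'.
  + by move=> e; apply: (@adj_irrefl (cone T_aleph0) h); rewrite {2}e.
  + by have [x [y [? ? ?]]] := touch_sym (Vt _ _ lt); exists x, y.
  + by have [x [y [? ? ?]]] := Vt _ _ lt; exists x, y.
Qed.

Section ConeTreeMinor.
Context {G : graph}.
Variables L X Y : set G.
Hypothesis st0 : state L X Y.
Hypothesis all_grow : forall L' X' Y' U W : set G, state L' X' Y' ->
  linkage L X Y L' X' Y' U W -> grows L' X' Y'.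

(** Linkage to the fixed state is what guarantees growth; continuation and child inherit it by
    transitivity. *)
Definition linked_state := {p : @state_triple G |
  exists U W, linkage L X Y (dom p) (endl p) (endr p) U W}.

Lemma growth_choice : exists (U W : linked_state -> set G)
    (nx ch : linked_state -> linked_state), forall p,
  growth (dom (sval p)) (endl (sval p)) (endr (sval p)) (U p) (W p)
    (dom (sval (nx p))) (endl (sval (nx p))) (endr (sval (nx p)))
    (dom (sval (ch p))) (endl (sval (ch p))) (endr (sval (ch p))).
Proof.
have /choice[f fP] (p : linked_state) :
    exists d : set G * set G * linked_state * linked_state,
    growth (dom (sval p)) (endl (sval p)) (endr (sval p)) d.1.1.1 d.1.1.2
      (dom (sval d.1.2)) (endl (sval d.1.2)) (endr (sval d.1.2))
      (dom (sval d.2)) (endl (sval d.2)) (endr (sval d.2)).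
  case: p => p [U0 [W0 lk]]; have st := triple_state p.
  have [U [W [L' [X' [Y' [K [V [T g]]]]]]]] := all_grow st lk.
  have lk1 := linkage_trans st lk (growth_linkage g).
  have lk2 := linkage_trans st lk (growth_child_linkage g).
  pose p1 : linked_state := exist _ (mk_state (grow_state g))
    (ex_intro _ _ (ex_intro _ _ lk1)).
  pose p2 : linked_state := exist _ (mk_state (grow_childstate g))
    (ex_intro _ _ (ex_intro _ _ lk2)).
  by exists (U, W, p1, p2).
by exists (fun p => (f p).1.1.1), (fun p => (f p).1.1.2), (fun p => (f p).1.2),
  (fun p => (f p).2).
Qed.

(* Reading a word from right to left, [true] enters a new child and [false]
   moves on to the next one: the second component is the tree vertex reached,
   the first the number of its children already passed. *)
Fixpoint walk (w : seq bool) : nat * seq nat :=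
  if w is c :: w' then
    if c then (0, (walk w').1 :: (walk w').2) else ((walk w').1.+1, (walk w').2)
  else (0, [::]).

Lemma walk_inj : injective walk.
Proof.
elim=> [|[] w IH] [|[] w'] //= [] // e1 e2; congr cons; apply: IH;
  by rewrite [LHS]surjective_pairing [RHS]surjective_pairing; congr pair.
Qed.

Lemma walk_surj (k : nat) (s : seq nat) : exists w, walk w = (k, s).
Proof.
elim: s k => [|n s IH]; elim=> [|k [w hw]]; try by exists (false :: w); rewrite /= hw.
  by exists [::].
by have [w hw] := IH n; exists (true :: w); rewrite /= hw.
Qed.

(** Right ends form the branch set of the apex, and left ends at the words leading to [s] that of
    [s]; only entering a child starts a new one. *)
Lemma cone_tree_minor_of_growth : minor (cone T_aleph0) G.
Proof.
have [U [W [nx [ch gr]]]] := growth_choice.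
have p0 : linked_state.
  by exists (mk_state st0), X, Y; exact: linkage_refl.
pose st := fix st (w : seq bool) : linked_state :=
  if w is c :: w' then if c then ch (st w') else nx (st w') else p0.
pose S w (b : bool) := if b then W (st w) else U (st w).
pose B w (b : bool) := if b then endr (sval (st w)) else endl (sval (st w)).
pose lab w (b : bool) := if b then None else Some (walk w).2.
have sys : binary_system (fun w => dom (sval (st w))) S B lab.
  split.
  - by move=> w []; [exact: grow_subr (gr (st w))|exact: grow_subl (gr (st w))].
  - by move=> w []; [exact: grow_Wl (gr (st w))|exact: grow_Ul (gr (st w))].
  - by move=> w [] /=; [exact: grow_child (gr (st w))|exact: grow_sub (gr (st w))].
  - by move=> w; exact: grow_disj (gr (st w)).
  - move=> w b c z Sz Lz; exists b; have g := gr (st w).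
    case: b c Sz Lz => [] [] /= Sz Lz; split=> //.
    + exact: (grow_childr g).
    + exact: (grow_meetr g).
    + by case: (grow_childl g Sz Lz).
    + by case: (grow_childl g Sz Lz).
    + exact: (grow_meetl g).
  - move=> w z L0 L1; have g := gr (st w).
    have Wz : W (st w) z by apply: (grow_apart g).
    by exists true, true; split=> //; [exact: (grow_meetr g)|exact: (grow_childr g)].
pose D (h : option (seq nat)) : set (seq bool * bool) := [set i | lab i.1 i.2 = h].
have Sc i : connected_set (S i.1 i.2).
  by case: i => w [] /=; [exact: grow_conr (gr (st w))|exact: grow_conl (gr (st w))].
have Bne w b : B w b !=set0.
  have h := triple_state (sval (st w)).
  by case: b; [exact: (state_conr h).1|exact: (state_conl h).1].
have D0 h : D h !=set0.
  case: h => [s|]; last by exists ([::], true).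
  by have [w hw] := walk_surj 0 s; exists (w, false); rewrite /D /= hw.
have edge s n : exists w, D (Some s) (w, false) /\ D (Some (n :: s)) (true :: w, false).
  by have [w hw] := walk_surj n s; exists w; rewrite /D /= hw.
have touch_child w : touch (S w false) (S (true :: w) false).
  apply: touchS (grow_hang (gr (st w))) => //.
  exact: grow_subl (gr (st (true :: w))).
have minE (h h' : option (seq nat)) i j : D h i -> D h' j ->
    touch (S i.1 i.2) (S j.1 j.2) -> exists x y,
    [/\ (\bigcup_(i in D h) S i.1 i.2) x, (\bigcup_(i in D h') S i.1 i.2) y
      & adj x y].
  by move=> Di Dj [x [y [Sx Sy xy]]]; exists x, y; split=> //; [exists i|exists j].
exists (fun h => \bigcup_(i in D h) S i.1 i.2); split.
- move=> h; have [i Di] := D0 h; have [[z Sz] _] := Sc i.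
  by exists z, i.
- apply/trivIsetP => h h' _ _ hh'; apply/seteqP; split=> // z.
  move=> [[[w b] /= Dh Sz] [[w' b'] /= Dh' Sz']].
  by move/eqP: hh'; apply; rewrite -Dh -Dh' (bs_label sys Sz Sz').
- move=> h; apply: connected_set_induced; apply: connected_bigcup => //.
  move=> E [i Di Ei] Ecl j Dj.
  have step c w b : D h (c :: w, b) -> D h (w, b) -> B (c :: w) b `<=` S w b ->
      (E (c :: w, b) <-> E (w, b)).
    move=> D1 D2 BS; have [z Bz] := Bne (c :: w) b.
    have t : S (c :: w) b `&` S w b !=set0.
      by exists z; split; [exact: (bs_end sys)|exact: BS].
    split=> Ek; [apply: Ecl D1 D2 Ek _|apply: Ecl D2 D1 Ek _]; left => //.
    by rewrite setIC.
  case: h Di Dj Ecl step => [s|] Di Dj Ecl step.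
  + have [w0 hw0] := walk_surj 0 s.
    (* Undoing continuations leads back to [w0], the word at which [s] is entered, unique because
       [walk] is injective. *)
    have Ew k : D (Some s) k -> (E k <-> E (w0, false)).
      case: k => w [] //=; elim: w => [|[] w IH] Dk.
      * suff -> : w0 = [::] by [].
        by apply: walk_inj; rewrite hw0; case: Dk => <-.
      * suff -> : w0 = true :: w by [].
        by apply: walk_inj; rewrite hw0 /=; case: Dk => <-.
      * rewrite -(IH Dk); apply: step => //; exact: grow_endl (gr (st w)).
    by apply/(Ew j Dj)/(Ew i Di).
  + have Ew k : D None k -> (E k <-> E ([::], true)).
      case: k => w [] //= _; elim: w => [|c w IH]; first by [].
      rewrite -IH; apply: step => //.
      case: c; [exact: grow_childend (gr (st w))|exact: grow_endr (gr (st w))].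
    by apply/(Ew j Dj)/(Ew i Di).
- move=> [s|] [s'|] //=.
  + move=> [[n ->]|[n ->]].
      have [w [Dw Dw']] := edge s n.
      exact: minE Dw Dw' (touch_child w).
    have [w [Dw Dw']] := edge s' n.
    exact: minE Dw' Dw (touch_sym (touch_child w)).
  + move=> _; have [w hw] := walk_surj 0 s.
    apply: (@minE _ _ (w, false) (w, true)); rewrite /D /= ?hw //.
    exact: grow_touch (gr (st w)).
  + move=> _; have [w hw] := walk_surj 0 s'.
    apply: (@minE _ _ (w, true) (w, false)); rewrite /D /= ?hw //.
    exact: touch_sym (grow_touch (gr (st w))).
Qed.

End ConeTreeMinor.

Theorem farey_or_cone_tree_minor (G : graph) : infinitely_edge_connected G ->
  minor farey_graph G \/ minor (cone T_aleph0) G.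
Proof.
move=> ec; have [L0 [X0 [Y0 st0]]] := infinitely_edge_connected_state ec.
have [spl|cl|[L [X [Y [st gr]]]]] := @split_clique_or_grow G.
- by left; apply: farey_minor_of_splits spl (mk_state st0).
- by right; exact: cone_tree_minor_of_clique.
- by right; exact: cone_tree_minor_of_growth st gr.
Qed.

(** * Incomparability *)

Lemma minor_trans (H G K : graph) : minor H G -> minor G K -> minor H K.
Proof.
move=> [V [V0 Vd Vc Ve]] [W [W0 Wd Wc We]].
exists (fun h => \bigcup_(g in V h) W g); split.
- by move=> h; have [g Vg] := V0 h; have [z Wz] := W0 g; exists z, g.
- move=> h h' _ _ [z [[g Vg Wz] [g' Vg' Wz']]].
  apply: Vd => //; exists g; split=> //.
  by have -> : g = g' by apply: Wd => //; exists z.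
- move=> h; apply: connected_set_induced; apply: connected_bigcup => //.
    by move=> g _; exact: induced_connected_set.
  move=> E Vh_E Ecl; have [_ Vhc] := induced_connected_set (V0 h) (Vc h).
  apply: Vhc => // u v Vu Vv uv Eu; apply: Ecl Vu Vv Eu _; right.
  by have [x [y [? ? ?]]] := We _ _ uv; exists x, y.
- move=> h h' /Ve[g [g' [Vg Vg' /We[x [y [Wx Wy xy]]]]]].
  by exists x, y; split=> //; [exists g|exists g'].
Qed.

(** * Edges of the Farey graph do not cross *)

Section FareyNoncrossing.
Local Open Scope ring_scope.

Definition farey_vec (x : farey_graph) : int * int := (farey_num x, farey_den x).

(** Since denominators are nonnegative, this is the order of the rationals with infinity as largest
    element. *)
Definition before (x y : farey_graph) : bool := det2 (farey_vec x) (farey_vec y) < 0.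

Lemma farey_vec_inj (x y : farey_graph) :
  det2 (farey_vec x) (farey_vec y) = 0 -> x = y.
Proof.
rewrite /det2 /farey_vec; case: x y => [x|] [y|] //=.
- move=> e; congr Some; rewrite -[x]divq_num_den -[y]divq_num_den; apply/eqP.
  by rewrite eqr_div ?intr_eq0 ?denq_neq0 // -!intrM eqr_int; apply/eqP; lia.
- by have := denq_gt0 x; lia.
- by have := denq_gt0 y; lia.
Qed.

Lemma before_neq (x y : farey_graph) : x <> y -> before y x = ~~ before x y.
Proof.
move=> xy; have n : det2 (farey_vec x) (farey_vec y) <> 0 by move/farey_vec_inj.
by rewrite /before [det2 (farey_vec y) _]det2C; lia.
Qed.

(* [x] and [y] separate [u] from [v] on the circle. *)
Definition crossing (x y u v : farey_graph) : bool :=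
  before x u (+) before x v (+) (before y u (+) before y v).

(* The four determinants between the two edges satisfy the Pluecker relation
   [a * d - b * c = 1] or [-1], while for crossing edges [a * d] and [b * c] are
   nonzero and have opposite signs. *)
Lemma farey_noncrossing (x y u v : farey_graph) : adj x y -> adj u v ->
  x <> u -> x <> v -> y <> u -> y <> v -> crossing x y u v = false.
Proof.
move=> xy uv xu xv yu yv.
have n z t : z <> t -> det2 (farey_vec z) (farey_vec t) <> 0 by move=> zt /farey_vec_inj.
have := n _ _ xu; have := n _ _ xv; have := n _ _ yu; have := n _ _ yv => {n}.
have pl : det2 (farey_vec x) (farey_vec u) * det2 (farey_vec y) (farey_vec v) -
    det2 (farey_vec x) (farey_vec v) * det2 (farey_vec y) (farey_vec u) =
    det2 (farey_vec x) (farey_vec y) * det2 (farey_vec u) (farey_vec v).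
  by rewrite /det2; ring.
have {xy uv} : det2 (farey_vec x) (farey_vec y) * det2 (farey_vec u) (farey_vec v) = 1 \/
    det2 (farey_vec x) (farey_vec y) * det2 (farey_vec u) (farey_vec v) = -1.
  move: xy uv; rewrite /= /farey_adj /det2 /=.
  by case=> -> [] ->; [left|right|right|left].
rewrite -{}pl /crossing /before.
move: (det2 _ (farey_vec u)) (det2 (farey_vec y) (farey_vec v)) => a d.
move: (det2 _ (farey_vec v)) (det2 _ (farey_vec u)) => b c.
move=> e d0 c0 b0 a0.
have [ha|ha] := ltrP a 0; have [hb|hb] := ltrP b 0;
  have [hc|hc] := ltrP c 0; have [hd|hd] := ltrP d 0 => //=; exfalso; case: e => e; nia.
Qed.

(** [crossing] is a sum of parities, additive along walks in either pair, so its vanishing spreads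
    from edges first through [B] and then through [A]. *)
Lemma connected_noncrossing (A B : set farey_graph) : connected_set A ->
  connected_set B -> disjoint A B -> forall a a' b b', A a -> A a' -> B b -> B b' ->
  crossing a a' b b' = false.
Proof.
move=> Ac Bc AB a a' b b' Aa Aa' Bb Bb'.
have edge x y : A x -> A y -> adj x y -> crossing x y b b' = false.
  move=> Ax Ay xy.
  have : B `<=` [set t | crossing x y b t = false].
    apply: Bc.2; first by exists b => //; rewrite /= /crossing !addbb.
    move=> u v Bu Bv uv /= h.
    have := farey_noncrossing xy uv.
    have ne z t : A z -> B t -> z <> t by move=> Az Bt zt; apply: (AB z) => //; rewrite zt.
    move=> /(_ (ne _ _ Ax Bu) (ne _ _ Ax Bv) (ne _ _ Ay Bu) (ne _ _ Ay Bv)).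
    move: h; rewrite /crossing.
    by case: (before x b) (before x u) (before x v) (before y b) (before y u)
      (before y v) => [] [] [] [] [] [].
  by move=> /(_ b' Bb').
have : A `<=` [set t | crossing a t b b' = false].
  apply: Ac.2; first by exists a => //; rewrite /= /crossing addbb.
  move=> u v Au Av uv /= h; have := edge u v Au Av uv.
  move: h; rewrite /crossing.
  by case: (before a b) (before a b') (before u b) (before u b') (before v b)
      (before v b') => [] [] [] [] [] [].
by move=> /(_ a' Aa').
Qed.

End FareyNoncrossing.

(* Of three points and a fourth one on a circle, the fourth and one of the three
   separate the other two; so the Farey graph has no K_{2,3} minor, but
   [T_aleph0 * t] contains one. *)
Lemma cone_tree_not_minor_farey : ~ minor (cone T_aleph0) farey_graph.
Proof.
move=> [V [V0 Vd Vc Ve]].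
have Vcon h : connected_set (V h) by exact: induced_connected_set.
have Vt (h h' : cone T_aleph0) : adj h h' -> touch (V h) (V h').
  by move=> /Ve[x [y [? ? ?]]]; exists x, y.
have dis h h' z : V h z -> V h' z -> h = h'.
  by move=> Vz Vz'; apply: Vd => //; exists z.
pose c n : cone T_aleph0 := Some [:: n].
pose r : cone T_aleph0 := Some [::].
(* The branch set of [c i] is merged with that of the apex, those of [c j] and [c k] with that of
   the root. *)
have key i j k x y z t : i != j -> i != k -> V None t -> V (c i) x ->
    V (c j) y -> V (c k) z -> crossing t x y z = false.
  move=> /eqP ij /eqP ik Vt' Vx Vy Vz.
  have Tc : connected_set (V None `|` V (c i)).
    by apply: connected_setU => //; right; exact: Vt.
  have Rc : connected_set (V r `|` V (c j) `|` V (c k)).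
    apply: connected_setU => //; last first.
      have rk : adj r (c k) by left; exists k.
      by right; apply: touchS (Vt _ _ rk) => // w; left.
    by apply: connected_setU => //; right; apply: Vt; left; exists j.
  apply: (connected_noncrossing Tc Rc); try by [left|right|left; right].
  move=> w [h1|h1] [[h2|h2]|h2]; have := dis _ _ _ h1 h2; rewrite /c /r //.
    by move=> [].
  by move=> [].
have [t Tt] := V0 None; have [x Vx] := V0 (c 0); have [y Vy] := V0 (c 1).
have [z Vz] := V0 (c 2).
have neq i j u v : i != j -> V (c i) u -> V (c j) v -> u <> v.
  by move=> /eqP ij Vu Vv uv; apply: ij; rewrite -uv in Vv; case: (dis _ _ _ Vu Vv).
have := key 0 1 2 x y z t isT isT Tt Vx Vy Vz.
have := key 1 0 2 y x z t isT isT Tt Vy Vx Vz.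
have := key 2 0 1 z x y t isT isT Tt Vz Vx Vy.
rewrite /crossing (before_neq (neq 0 1 x y isT Vx Vy)).
rewrite (before_neq (neq 0 2 x z isT Vx Vz)) (before_neq (neq 1 2 y z isT Vy Vz)).
by case: (before t x) (before t y) (before t z) (before x y) (before x z)
  (before y z) => [] [] [] [] [] [].
Qed.

(** * The tree has no triangle minor *)

Section TreeMinor.
Implicit Types A B C : set T_aleph0.

(** The subtree at [n :: a] can be left only through [a]. *)
Lemma tree_connected_above B (n : nat) (a : seq nat) : connected_set B ->
  B (n :: a) -> ~ B a -> forall x : seq nat, B x -> exists s, x = s ++ n :: a.
Proof.
move=> Bc Bb nBa; apply: (Bc.2 [set x | exists s, x = s ++ n :: a]).
  by exists (n :: a) => //; exists [::].
move=> u v Bu Bv [[m ->]|[m uE]] [s us]; first by exists (m :: s); rewrite us.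
case: s us => [|k s] us; last by exists s; move: us; rewrite uE => -[].
by move: us; rewrite uE => -[_ va]; rewrite va in Bv.
Qed.

Definition hangs B A := exists (n : nat) (a : seq nat), A a /\ B (n :: a).

Lemma touch_hangs A B : touch A B -> hangs B A \/ hangs A B.
Proof.
by move=> [x [y [Ax By [[n e]|[n e]]]]]; [left; exists n, x|right; exists n, y];
  rewrite -e.
Qed.

(** A connected set that hangs has a vertex nearest to the root, and only the parent of that vertex
    can carry it. *)
Lemma hangs_once A B C : connected_set B -> disjoint A B -> disjoint C B ->
  disjoint A C -> hangs B A -> hangs B C -> False.
Proof.
move=> Bc AB CB AC [n [a [Aa Ba]]] [m [c [Cc Bcm]]].
have [s es] := tree_connected_above Bc Ba (AB _ Aa) Bcm.
have [s' es'] := tree_connected_above Bc Bcm (CB _ Cc) Ba.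
have /(congr1 size) := es; have /(congr1 size) := es'; rewrite !size_cat /= => h1 h2.
have s0 : s = [::] by apply: size0nil; lia.
by move: es; rewrite s0 => -[_ ca]; apply: (AC a) => //; rewrite -ca.
Qed.

Lemma hangs_size A B x : connected_set B -> disjoint A B -> hangs B A -> B x ->
  exists a : seq nat, A a /\ (size a < size (x : seq nat))%N.
Proof.
move=> Bc AB [n [a [Aa Ba]]] Bx; exists a; split=> //.
by have [s ->] := tree_connected_above Bc Ba (AB _ Aa) Bx; rewrite size_cat /=; lia.
Qed.

(** Each step around the cycle reaches a vertex strictly nearer to the root, an infinite descent. *)
Lemma hangs_cycle A B C : connected_set A -> connected_set B -> connected_set C ->
  disjoint A B -> disjoint B C -> disjoint C A ->
  hangs B A -> hangs C B -> hangs A C -> False.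
Proof.
move=> Ac Bc Cc AB BC CA hB hC hA.
have none k (x : seq nat) : (size x <= k)%N -> A x -> False.
  elim: k x => [|k IH] x xk Ax.
    by have [c [_ cx]] := hangs_size Ac CA hA Ax; lia.
  have [c [Cc' cx]] := hangs_size Ac CA hA Ax.
  have [b [Bb bc]] := hangs_size Cc BC hC Cc'.
  have [a [Aa ab]] := hangs_size Bc AB hB Bb.
  by apply: IH Aa; lia.
by have [[x Ax] _] := Ac; exact: none (leqnn _) Ax.
Qed.

(** Each contact hangs one set from the other: either the three form a cycle, or one set hangs from
    both others. *)
Lemma tree_no_triangle A B C : connected_set A -> connected_set B ->
  connected_set C -> disjoint A B -> disjoint B C -> disjoint C A ->
  touch A B -> touch B C -> touch C A -> False.
Proof.
move=> Ac Bc Cc AB BC CA /touch_hangs hAB /touch_hangs hBC /touch_hangs hCA.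
have sy (P Q : set T_aleph0) : disjoint P Q -> disjoint Q P by move=> PQ z Qz Pz; exact: PQ Pz Qz.
case: hAB hBC hCA => [h1|h1] [h2|h2] [h3|h3].
- exact: hangs_cycle h1 h2 h3.
- exact: hangs_once Cc BC (sy _ _ CA) (sy _ _ AB) h2 h3.
- exact: hangs_once Bc AB (sy _ _ BC) (sy _ _ CA) h1 h2.
- exact: hangs_once Bc AB (sy _ _ BC) (sy _ _ CA) h1 h2.
- exact: hangs_once Ac (sy _ _ AB) CA BC h1 h3.
- exact: hangs_once Cc BC (sy _ _ CA) (sy _ _ AB) h2 h3.
- exact: hangs_once Ac (sy _ _ AB) CA BC h1 h3.
- exact: hangs_cycle Ac Cc Bc (sy _ _ CA) (sy _ _ BC) (sy _ _ AB) h3 h2 h1.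
Qed.

End TreeMinor.

(* One of two disjoint triangles avoids the branch set of the apex. *)
Lemma farey_not_minor_cone_tree : ~ minor farey_graph (cone T_aleph0).
Proof.
move=> [V [V0 Vd Vc Ve]].
have dis h h' z : V h z -> V h' z -> h = h'.
  by move=> Vz Vz'; apply: Vd => //; exists z.
pose U h : set T_aleph0 := [set s | V h (Some s)].
have VU h z : ~ V h None -> V h z -> exists2 s, z = Some s & U h s.
  by case: z => [s|] // _ Vz; exists s.
have Uc h : ~ V h None -> connected_set (U h).
  move=> nV; have [[z Vz] Vhc] := induced_connected_set (V0 h) (Vc h); split.
    by have [s _ Us] := VU _ _ nV Vz; exists s.
  move=> A [u Uu Au] Acl v Uv.
  apply: (Vhc [set x : cone T_aleph0 | if x is Some s then A s else False] _ _ (Some v)) => //.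
    by exists (Some u).
  by move=> [x|] [y|] // Vx Vy xy Ax; exact: Acl xy Ax.
have Ut (h h' : farey_graph) : ~ V h None -> ~ V h' None -> adj h h' -> touch (U h) (U h').
  move=> nV nV' /Ve[x [y [Vx Vy]]].
  have [s -> Us] := VU _ _ nV Vx; have [s' -> Us'] := VU _ _ nV' Vy => xy.
  by exists s, s'.
have Ud h h' : h <> h' -> disjoint (U h) (U h').
  by move=> hh' s Us Us'; apply: hh'; exact: dis Us Us'.
have tri (x y z : farey_graph) : adj x y -> adj y z -> adj z x ->
    ~ V x None -> ~ V y None -> ~ V z None -> False.
  have ne (u v : farey_graph) : adj u v -> u <> v.
    by move=> uv e; apply: (@adj_irrefl farey_graph u); rewrite {2}e.
  move=> xy yz zx nx ny nz.
  apply: (@tree_no_triangle (U x) (U y) (U z)); try exact: Uc;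
    by [apply: Ud; exact: ne|apply: Ut].
(* The two triangles are infinity, 0, 1 and 1/2, 2/5, 1/3. *)
have t1 : ~ (~ V None None /\ ~ V (Some 0%R) None /\ ~ V (Some 1%R) None).
  by move=> [n1 [n2 n3]]; apply: (tri None (Some 0%R) (Some 1%R)) => //;
    rewrite /= /farey_adj /=; [left|right|right].
have t2 : ~ (~ V (Some (1 / 2%:R)%R) None /\ ~ V (Some (2%:R / 5%:R)%R) None
          /\ ~ V (Some (1 / 3%:R)%R) None).
  by move=> [n1 [n2 n3]];
    apply: (tri (Some (1 / 2%:R)%R) (Some (2%:R / 5%:R)%R) (Some (1 / 3%:R)%R)) => //;
    rewrite /= /farey_adj /=; [left|left|right].
have [[h h1 no]|no] := EM (exists2 h, V h None &
  h = None \/ h = Some 0%R \/ h = Some 1%R); last first.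
  by apply: t1; split; [|split] => h; apply: no; eexists; try exact: h; tauto.
by apply: t2; split; [|split] => /(dis _ _ _ h1) e; move: no; rewrite e => -[|[]].
Qed.

Theorem theorem2 (HH : set graph)
  (HH_iec : forall G, HH G -> infinitely_edge_connected G)
  (HH_minor : forall G, infinitely_edge_connected G ->
     exists H, HH H /\ minor H G)
  (HH_antichain : forall H H', HH H -> HH H' -> H <> H' -> ~ minor H H') :
  exists A B : graph,
    [/\ A <> B,
        HH = [set A; B],
        minor_equivalent A farey_graph
      & minor_equivalent B (cone T_aleph0)].
Proof.
have [A [HA AF]] := HH_minor _ farey_infinitely_edge_connected.
have [B [HB BT]] := HH_minor _ cone_tree_infinitely_edge_connected.
(* Were the cone a minor of [A], it would be one of the Farey graph; [B] is treated alike. *)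
have FA : minor farey_graph A.
  have [//|TA] := farey_or_cone_tree_minor (HH_iec _ HA).
  by case: cone_tree_not_minor_farey; exact: minor_trans TA AF.
have TB : minor (cone T_aleph0) B.
  have [FB|//] := farey_or_cone_tree_minor (HH_iec _ HB).
  by case: farey_not_minor_cone_tree; exact: minor_trans FB BT.
exists A, B; split=> //.
- by move=> e; apply: farey_not_minor_cone_tree; apply: minor_trans FA _; rewrite e.
- apply/seteqP; split=> [C HC|C [->|->]] //.
  (* Every member has [A] or [B] as a minor through one of the two graphs, and the antichain
     condition forces equality. *)
  have [FC|TC] := farey_or_cone_tree_minor (HH_iec _ HC).
    left; apply: contrapT => CA; apply: (HH_antichain A C) => //.
      by move=> e; apply: CA.
    exact: minor_trans AF FC.
  right; apply: contrapT => CB; apply: (HH_antichain B C) => //.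
    by move=> e; apply: CB.
  exact: minor_trans BT TC.
Qed.
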